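(* Let $n\ge1$. The cyclotomic quotient $\mathcal{A}_n^{\mathbf{C}}(F)$ is an $\mathbb{N}$-graded Frobenius superalgebra with trace map $\operatorname{tr}_{\mathbf{C}}$ and Nakayama automorphism given by $$x_i\mapsto x_i,\quad\mathbf{f}\mapsto(\psi^{d_{\mathbf{C}}})^{\otimes n}(\mathbf{f}),\quad\pi\mapsto\pi,\qquad1\le i\le n,\ \mathbf{f}\in F^{\otimes n},\ \pi\in S_n.$$ It follows that $\mathcal{A}_n^{\mathbf{C}}(F)$ is a symmetric algebra if the level $d_{\mathbf{C}}$ is a multiple of the order of the Nakayama automorphism $\psi$ of $F$. In particular, if $F$ is a symmetric algebra (i.e. $\psi=\operatorname{id}$), then so is $\mathcal{A}_n^{\mathbf{C}}(F)$.
   Context: $\Bbbk$ is a commutative ring of characteristic not equal to $2$; $\mathbb{N}$ is the set of nonnegative integers. ''Algebra'' means associative unital $\mathbb{Z}$-graded $\Bbbk$-superalgebra; $|a|$ is the degree and $\bar a$ the parity. Tensor products are over $\Bbbk$, with $(a_1\otimes a_2)(b_1\otimes b_2)=(-1)^{\bar a_2\bar b_1}a_1b_1\otimes a_2b_2$. An $\mathbb{N}$-graded Frobenius superalgebra is an $\mathbb{N}$-graded superalgebra $A$ with a parity-preserving linear trace map $\operatorname{tr}\colon A\to\Bbbk$, homogeneous in degree, such that $f\mapsto(g\mapsto(-1)^{\bar f\bar g}\operatorname{tr}(gf))$ is an isomorphism $A\to\operatorname{Hom}_\Bbbk(A,\Bbbk)$. Its Nakayama automorphism $\psi$ is defined by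 $\operatorname{tr}(fg)=(-1)^{\bar f\bar g}\operatorname{tr}(g\psi(f))$; $A$ is a symmetric algebra if $\psi=\operatorname{id}$. $F$ is an $\mathbb{N}$-graded Frobenius superalgebra, free of finite rank over $\Bbbk$, with trace $\operatorname{tr}$, Nakayama automorphism $\psi$, and maximum degree $\delta$. It is assumed that $\psi$ has finite order $\theta$, that the characteristic of $\Bbbk$ does not divide $\theta$, and that $F$ has a basis of eigenvectors of $\psi$. $B$ is a homogeneous basis of $F$ and $\{b^\vee\}$ its left dual basis: $\operatorname{tr}(b^\vee c)=\delta_{b,c}$. For $f\in F$: $f_i=1^{\otimes(i-1)}\otimes f\otimes1^{\otimes(n-i)}\in F^{\otimes n}$ and $\psi_i=\operatorname{id}^{\otimes(i-1)}\otimes\psi\otimes\operatorname{id}^{\otimes(n-i)}$. $S_n$ acts on $F^{\otimes n}$ by superpermuting factors, written ${}^\pi\mathbf{f}$: ${}^{s_i}(f_1\otimes\cdots\otimes f_n)=(-1)^{\bar f_i\bar f_{i+1}}f_1\otimes\cdots\otimes f_{i+1}\otimes f_i\otimes\cdots\otimes f_n$, with $s_i$ the transposition of $i,i+1$. The affine wreath product algebra $\mathcal{A}_n(F)$ is the free product $\Bbbk[x_1,\dots,x_n]\star F^{\otimes n}\star\Bbbk S_n$ modulo the relations: $\mathbf{f}x_i=x_i\psi_i(\mathbf{f})$; $s_ix_j=x_js_i$ ($j\ne i,i+1$); $s_ix_i=x_{i+1}s_i-t_{i,i+1}$; $\pi\mathbf{f}={}^\pi\mathbf{f}\,\pi$ ($\pi\in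 S_n$), where $t_{i,j}=\sum_{b\in B}b_i(b^\vee)_j$ for $i\neq j$. Gradings: $|x_i|=\delta$, $\bar x_i=0$; $f_i$ has the degree and parity of $f$; $\pi\in S_n$ has degree and parity $0$. For $\alpha\in\mathbb{N}^n$, $x^\alpha=x_1^{\alpha_1}\cdots x_n^{\alpha_n}$. For $k\in\mathbb{Z}$: $F_\psi=\{f\in F\mid\psi(f)=f\}$, $F^{(k)}=\{f\in F\mid gf=(-1)^{\bar f\bar g}f\psi^k(g)\ \forall g\in F\}$, $F_\psi^{(k)}=F^{(k)}\cap F_\psi$. $\mathbf{F}_1^{(k)}$ is the set of elements of $F_\psi^{(k)}\otimes(F_\psi^{(0)})^{\otimes(n-1)}\subseteq F^{\otimes n}$ invariant under $\{\pi\in S_n\mid\pi(1)=1\}$. For $1\le k\le\theta$ choose $e_k\in\mathbb{N}$ and even elements $\mathbf{c}^{(k,1)},\dots,\mathbf{c}^{(k,e_k)}\in\mathbf{F}_1^{(k)}$ of degree $k\delta$, and let $\mathbf{C}$ be the tuple of all these elements. Let $\chi_{\mathbf{C}}=\prod_{k=1}^\theta\prod_{j=1}^{e_k}(x_1^k-\mathbf{c}^{(k,j)})$, let $J_{\mathbf{C}}$ be the two-sided ideal of $\mathcal{A}_n(F)$ generated by $\chi_{\mathbf{C}}$, and $\mathcal{A}_n^{\mathbf{C}}(F)=\mathcal{A}_n(F)/J_{\mathbf{C}}$. The level is $d=d_{\mathbf{C}}=\sum_{k=1}^\theta ke_k$. The images of $x^\alpha\mathbf{b}\pi$ with $\alpha_1,\dots,\alpha_n<d$,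 $\mathbf{b}\in\{b_1\otimes\cdots\otimes b_n\mid b_i\in B\}$, $\pi\in S_n$, form a $\Bbbk$-basis of $\mathcal{A}_n^{\mathbf{C}}(F)$. The even linear map $\operatorname{tr}_{\mathbf{C}}\colon\mathcal{A}_n^{\mathbf{C}}(F)\to\Bbbk$ is defined by $\operatorname{tr}_{\mathbf{C}}(x^\alpha\mathbf{f}\pi)=\delta_{\alpha,(d-1,\dots,d-1)}\operatorname{tr}^{\otimes n}(\mathbf{f})\,\delta_{\pi,1}$ for $\mathbf{f}\in F^{\otimes n}$, $\pi\in S_n$, $\alpha\in\mathbb{N}^n$ with all $\alpha_i<d$. *)

(* Defs.v *)
From HB Require Import structures.
From mathcomp Require Import all_boot all_order all_fingroup all_algebra.
From mathcomp Require Import boolp.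
From mathcomp.multinomials Require Import monalg.

Set Implicit Arguments.
Unset Strict Implicit.
Unset Printing Implicit Defensive.

Import GRing.Theory.
Local Open Scope ring_scope.
Local Open Scope quotient_scope.

(* MathComp's algType excludes the zero ring, but a cyclotomic quotient of
   level 0 is zero.  So a k-algebra is a unital associative ring, possibly
   zero, with a ring morphism from k to its centre. *)
Record pzAlg (k : comNzRingType) := PzAlg {
  alg_ring : pzRingType;
  alg_in : {rmorphism k -> alg_ring};
  alg_central : forall a x, alg_in a * x = x * alg_in a
}.

Definition alg_car (k : comNzRingType) (A : pzAlg k) : Type := alg_ring A.
Coercion alg_car : pzAlg >-> Sortclass.

Section AlgebraScaling.
Variables (k : comNzRingType) (A : pzAlg k).

HB.instance Definition _ := GRing.PzRing.on (alg_car A).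

Definition alg_scale (a : k) (x : A) : A := alg_in A a * x.

Lemma alg_scaleA a b x : alg_scale a (alg_scale b x) = alg_scale (a * b) x.
Proof. by rewrite /alg_scale rmorphM mulrA. Qed.
Lemma alg_scale1 : left_id 1 alg_scale.
Proof. by move=> x; rewrite /alg_scale rmorph1 mul1r. Qed.
Lemma alg_scaleDr : right_distributive alg_scale +%R.
Proof. by move=> a x y; rewrite /alg_scale mulrDr. Qed.
Lemma alg_scaleDl x : {morph alg_scale^~ x : a b / a + b}.
Proof. by move=> a b; rewrite /alg_scale rmorphD mulrDl. Qed.

HB.instance Definition _ := GRing.Zmodule_isLmodule.Build k (alg_car A)
  alg_scaleA alg_scale1 alg_scaleDr alg_scaleDl.

Lemma algZE (a : k) (x : A) : a *: x = alg_in A a * x.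
Proof. by []. Qed.
End AlgebraScaling.

Section FreeAlgebra.
Variables (k : comNzRingType) (X : choiceType).

Lemma malgC_central (a : k) (x : {malg k[{fmonom X}]}) :
  a%:MP * x = x * a%:MP.
Proof.
rewrite mul_malgC [a *: x]malgZ_def [x * _]malgM_def fgmulgU.
by apply: eq_bigr => m _; rewrite mulm1 mulrC.
Qed.

Definition freeAlg : pzAlg k := PzAlg malgC_central.

Definition freeGen (x : X) : freeAlg := mkmalgU (fmu x) 1.
End FreeAlgebra.

Inductive idealGen (A : pzRingType) (R : A -> Prop) : A -> Prop :=
| ideal_base r : R r -> idealGen R r
| ideal0 : idealGen R 0
| idealD x y : idealGen R x -> idealGen R y -> idealGen R (x + y)
| idealMl a x : idealGen R x -> idealGen R (a * x)
| idealMr a x : idealGen R x -> idealGen R (x * a).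

Section Quotient.
Variables (k : comNzRingType) (A : pzAlg k) (R : A -> Prop).

Definition ideal_eqv (x y : A) : bool := `[< idealGen R (x - y) >].

Lemma idealN x : idealGen R x -> idealGen R (- x).
Proof. by rewrite -mulN1r; apply: idealMl. Qed.

Lemma ideal_eqv_refl : reflexive ideal_eqv.
Proof. by move=> x; apply/asboolP; rewrite subrr; apply: ideal0. Qed.

Lemma ideal_eqv_sym : symmetric ideal_eqv.
Proof.
by move=> x y; apply/asboolP/asboolP => /idealN; rewrite opprB.
Qed.

Lemma ideal_eqv_trans : transitive ideal_eqv.
Proof.
move=> y x z /asboolP xy /asboolP yz; apply/asboolP.
have -> : x - z = (x - y) + (y - z) by rewrite addrA subrK.
exact: idealD.
Qed.

Canonical ideal_equiv :=
  EquivRel ideal_eqv ideal_eqv_refl ideal_eqv_sym ideal_eqv_trans.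

Definition quotRing : Type := {eq_quot ideal_equiv}.
HB.instance Definition _ := EqQuotient.on quotRing.
HB.instance Definition _ := Choice.on quotRing.

Definition quotPi (x : A) : quotRing := \pi x.

Lemma quotPiP x y : idealGen R (x - y) <-> quotPi x = quotPi y.
Proof.
split=> [h|/eqmodP/asboolP//]; exact/eqmodP/asboolP.
Qed.

Lemma quotPi_ind (P : quotRing -> Prop) : (forall x, P (quotPi x)) -> forall u, P u.
Proof. by move=> h u; rewrite -(reprK u); exact: h. Qed.

Let qrepr (u : quotRing) : A := generic_quotient.repr u.
Let qreprK u : quotPi (qrepr u) = u.
Proof. exact: reprK. Qed.
Let qreprP x : idealGen R (qrepr (quotPi x) - x).
Proof. by apply/quotPiP; rewrite qreprK. Qed.

Definition qadd (u v : quotRing) : quotRing := quotPi (qrepr u + qrepr v).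
Definition qopp (u : quotRing) : quotRing := quotPi (- qrepr u).
Definition qmul (u v : quotRing) : quotRing := quotPi (qrepr u * qrepr v).

Lemma qaddE x y : qadd (quotPi x) (quotPi y) = quotPi (x + y).
Proof.
apply/quotPiP; rewrite opprD addrACA.
by apply: idealD; apply: qreprP.
Qed.

Lemma qoppE x : qopp (quotPi x) = quotPi (- x).
Proof. by apply/quotPiP; rewrite -opprD; apply/idealN/qreprP. Qed.

Lemma qmulE x y : qmul (quotPi x) (quotPi y) = quotPi (x * y).
Proof.
apply/quotPiP; set x' := qrepr _; set y' := qrepr (quotPi y).
have -> : x' * y' - x * y = (x' - x) * y' + x * (y' - y).
  by rewrite mulrBl mulrBr addrA subrK.
by apply: idealD; [apply/idealMr/qreprP | apply/idealMl/qreprP].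
Qed.

Let qE := (qaddE, qoppE, qmulE).

Lemma qaddA : associative qadd.
Proof. by do 3![elim/quotPi_ind => ?]; rewrite !qE addrA. Qed.
Lemma qaddC : commutative qadd.
Proof. by do 2![elim/quotPi_ind => ?]; rewrite !qE addrC. Qed.
Lemma qadd0 : left_id (quotPi 0) qadd.
Proof. by elim/quotPi_ind => ?; rewrite !qE add0r. Qed.
Lemma qaddN : left_inverse (quotPi 0) qopp qadd.
Proof. by elim/quotPi_ind => ?; rewrite !qE addNr. Qed.

HB.instance Definition _ :=
  GRing.isZmodule.Build quotRing qaddA qaddC qadd0 qaddN.

Lemma qmulA : associative qmul.
Proof. by do 3![elim/quotPi_ind => ?]; rewrite !qE mulrA. Qed.
Lemma qmul1l : left_id (quotPi 1) qmul.
Proof. by elim/quotPi_ind => ?; rewrite !qE mul1r. Qed.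
Lemma qmul1r : right_id (quotPi 1) qmul.
Proof. by elim/quotPi_ind => ?; rewrite !qE mulr1. Qed.
Lemma qmulDl : left_distributive qmul +%R.
Proof.
by do 3![elim/quotPi_ind => ?]; rewrite /GRing.add /= !qE mulrDl.
Qed.
Lemma qmulDr : right_distributive qmul +%R.
Proof.
by do 3![elim/quotPi_ind => ?]; rewrite /GRing.add /= !qE mulrDr.
Qed.

HB.instance Definition _ :=
  GRing.Zmodule_isPzRing.Build quotRing qmulA qmul1l qmul1r qmulDl qmulDr.

Definition qin (a : k) : quotRing := quotPi (alg_in A a).

Lemma qin_additive : zmod_morphism qin.
Proof.
by move=> a b; rewrite /GRing.opp /GRing.add /= qoppE qaddE /qin rmorphB.
Qed.

Lemma qin_monoid : monoid_morphism qin.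
Proof.
by split; [rewrite /qin rmorph1 | move=> a b; rewrite /GRing.mul /= qmulE /qin rmorphM].
Qed.

HB.instance Definition _ := GRing.isZmodMorphism.Build k quotRing qin qin_additive.
HB.instance Definition _ := GRing.isMonoidMorphism.Build k quotRing qin qin_monoid.

Lemma qin_central a (u : quotRing) : qin a * u = u * qin a.
Proof.
by elim/quotPi_ind: u => x; rewrite /GRing.mul /= !qmulE [_ * x]alg_central.
Qed.

Definition quotAlg : pzAlg k := PzAlg qin_central.
Definition quotMap (x : A) : quotAlg := quotPi x.
End Quotient.

(* gens d p a : a is a generator of degree d and parity p (true means odd). *)
Inductive homGen (k : comNzRingType) (A : pzAlg k)
    (gens : nat -> bool -> A -> Prop) : nat -> bool -> A -> Prop :=
| hom_base d p a : gens d p a -> homGen gens d p a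
| hom_one : homGen gens 0 false 1
| hom_zero d p : homGen gens d p 0
| hom_lin d p c a b : homGen gens d p a -> homGen gens d p b ->
    homGen gens d p (c *: a + b)
| hom_mul d e p q a b : homGen gens d p a -> homGen gens e q b ->
    homGen gens (d + e)%N (p (+) q) (a * b).

Inductive lspan (k : comNzRingType) (V : lmodType k) (S : V -> Prop) :
    V -> Prop :=
| lspan_base v : S v -> lspan S v
| lspan0 : lspan S 0
| lspan_lin a u v : lspan S u -> lspan S v -> lspan S (a *: u + v).

Definition is_basis (k : comNzRingType) (V : lmodType k) (J : finType)
    (v : J -> V) : Prop :=
  forall u, exists! c : {ffun J -> k}, u = \sum_j c j *: v j.

Definition has_char (k : comNzRingType) (c : nat) : Prop :=
  forall m : nat, (m%:R == 0 :> k) = (c %| m)%N.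

Definition has_order (T : Type) (f : T -> T) (r : nat) : Prop :=
  [/\ (0 < r)%N, iter r f =1 id
    & forall j, (0 < j < r)%N -> ~ (iter j f =1 id)].

Section Superalgebras.
Variables (k : comNzRingType) (A : pzAlg k).

(* h d p a : a is homogeneous of degree d and parity p. *)
Variable h : nat -> bool -> A -> Prop.

Record graded_superalgebra : Prop := {
  gsa_zero : forall d p, h d p 0;
  gsa_lin : forall d p c a b, h d p a -> h d p b -> h d p (c *: a + b);
  gsa_one : h 0 false 1;
  gsa_mul : forall d e p q a b,
    h d p a -> h e q b -> h (d + e)%N (p (+) q) (a * b);
  gsa_span : forall a, exists N (c : nat -> bool -> A),
    (forall d p, h d p (c d p)) /\ a = \sum_(d < N) \sum_(p : bool) c d p;
  gsa_indep : forall N (c : nat -> bool -> A),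
    (forall d p, h d p (c d p)) -> \sum_(d < N) \sum_(p : bool) c d p = 0 ->
    forall d p, (d < N)%N -> c d p = 0
}.

Definition max_degree (D : nat) : Prop :=
  (exists p a, h D p a /\ a <> 0) /\
  (forall d p a, h d p a -> (D < d)%N -> a = 0).

Variable tr : A -> k.

(* Signs involving the parity of a possibly inhomogeneous element are extended
   from homogeneous elements by bilinearity; this is the role of Phi below. *)
Record graded_frobenius : Prop := {
  gf_graded : graded_superalgebra;
  gf_linear : scalar tr;
  gf_even : forall d a, h d true a -> tr a = 0;
  gf_homogeneous : exists D, forall d p a, h d p a -> d <> D -> tr a = 0;
  gf_iso : exists Phi : A -> A -> k,
    [/\ forall f, scalar (Phi f),
        forall g, scalar (Phi^~ g),
        forall d e p q f g, h d p f -> h e q g ->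
          Phi f g = (-1) ^+ (p && q) * tr (g * f)
      & forall phi : A -> k, scalar phi -> exists! f, Phi f =1 phi]
}.

Definition is_nakayama (psi : A -> A) : Prop :=
  [/\ linear psi, monoid_morphism psi, bijective psi
    & forall d e p q f g, h d p f -> h e q g ->
        tr (f * g) = (-1) ^+ (p && q) * tr (g * psi f)].

Definition symmetric_algebra : Prop :=
  graded_frobenius /\ is_nakayama id.
End Superalgebras.

(* Underlying data, constrained by is_frobData below: the grading, the trace,
   the Nakayama automorphism, a homogeneous basis fB with its left dual basis
   fBv, the degrees and parities of the elements of fB, the maximum degree. *)
Record frobData (k : comNzRingType) := FrobData {
  fAlg :> pzAlg k;
  fHom : nat -> bool -> fAlg -> Prop;
  fTr : fAlg -> k;
  fPsi : fAlg -> fAlg;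
  fIdx : finType;
  fB : fIdx -> fAlg;
  fBv : fIdx -> fAlg;
  fDeg : fIdx -> nat;
  fPar : fIdx -> bool;
  fDelta : nat
}.
Arguments fHom {k} F : rename.
Arguments fTr {k} F : rename.
Arguments fPsi {k} F : rename.
Arguments fIdx {k} F : rename.
Arguments fB {k} F : rename.
Arguments fBv {k} F : rename.
Arguments fDeg {k} F : rename.
Arguments fPar {k} F : rename.
Arguments fDelta {k} F : rename.

Record is_frobData (k : comNzRingType) (F : frobData k) : Prop := {
  fd_frobenius : graded_frobenius (fHom F) (fTr F);
  fd_nakayama : is_nakayama (fHom F) (fTr F) (fPsi F);
  fd_basis : is_basis (fB F);
  fd_homogeneous : forall b, fHom F (fDeg F b) (fPar F b) (fB F b);
  fd_dual : forall b c, fTr F (fBv F b * fB F c) = (b == c)%:R;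
  fd_delta : max_degree (fHom F) (fDelta F)
}.

Definition eigenbasis (k : comNzRingType) (F : frobData k) : Prop :=
  exists (J : finType) (v : J -> F) (lam : J -> k),
    is_basis v /\ forall j, fPsi F (v j) = lam j *: v j.

Section TensorPower.
Variables (k : comNzRingType) (F : frobData k) (n : nat).

Definition tidx := {ffun 'I_n -> fIdx F}.

(* The n-th tensor power of F, in coordinates on the basis of the tensors
   b_1 (x) ... (x) b_n.  Its product is tmul, not the pointwise product that
   {ffun _ -> _} inherits from k. *)
Definition tpow := {ffun tidx -> k^o}.

Implicit Types (T U : tpow) (a b c : tidx).

(* f_1 (x) ... (x) f_n; the coefficient of b in f is tr(b^v f). *)
Definition pure (f : 'I_n -> F) : tpow :=
  [ffun b : tidx => \prod_i fTr F (fBv F (b i) * f i)].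

Definition tone : tpow := pure (fun _ => 1).

Definition tat (i : 'I_n) (f : F) : tpow :=
  pure (fun j => if j == i then f else 1).

Definition tmul T U : tpow :=
  \sum_a \sum_c (T a * U c *
      (-1) ^+ (\sum_(i < n) \sum_(j < n | (j < i)%N)
                 (fPar F (a i) && fPar F (c j)))%N)
    *: pure (fun i => fB F (a i) * fB F (c i)).

(* phi_1 (x) ... (x) phi_n, for even linear endomorphisms phi_i of F. *)
Definition tmap (phi : 'I_n -> F -> F) T : tpow :=
  \sum_a T a *: pure (fun i => phi i (fB F (a i))).

Definition tpsi (i : 'I_n) : tpow -> tpow :=
  tmap (fun j => if j == i then fPsi F else id).

Definition ttr T : k := \sum_a T a * \prod_i fTr F (fB F (a i)).

(* The factor in position i moves to position s i, and each inversion of s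
   between odd factors contributes a sign. *)
Definition tact (s : 'S_n) T : tpow :=
  [ffun b : tidx =>
    (-1) ^+ (\sum_(i < n) \sum_(j < n | (i < j)%N && (s j < s i)%N)
               (fPar F (b (s i)) && fPar F (b (s j))))%N
    * T [ffun i => b (s i)]].

Definition thom (d : nat) (p : bool) T : Prop :=
  forall b, T b <> 0 -> (\sum_i fDeg F (b i))%N = d /\
                        odd (\sum_i fPar F (b i))%N = p.

Definition tt_ (i j : 'I_n) : tpow :=
  \sum_b tmul (tat i (fB F b)) (tat j (fBv F b)).
End TensorPower.

Section Centres.
Variables (k : comNzRingType) (F : frobData k).

Definition has_parity (p : bool) (f : F) : Prop :=
  exists N (c : nat -> F),
    (forall d, fHom F d p (c d)) /\ f = \sum_(d < N) c d.

Definition Fpsi (f : F) : Prop := fPsi F f = f.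

(* The m-twisted centre: g f = (-1)^(|f||g|) f psi^m(g), with the sign extended
   bilinearly, so that f is split into its even and odd parts f_ p. *)
Definition Ftw (m : nat) (f : F) : Prop :=
  exists f_ : bool -> F,
    [/\ forall p, has_parity p (f_ p), f = \sum_(p : bool) f_ p
      & forall e q g, fHom F e q g ->
          g * f = \sum_(p : bool)
                    (-1) ^+ (p && q) * (f_ p * iter m (fPsi F) g)].

Definition Ftwpsi (m : nat) (f : F) : Prop := Ftw m f /\ Fpsi f.

(* Positions 1, ..., n with n >= 1 are indexed by 'I_n.+1 from here on where a
   first position is needed; position 1 is ord0. *)
Definition F1 (n m : nat) (T : tpow F n.+1) : Prop :=
  lspan (fun U => exists f : 'I_n.+1 -> F,
           [/\ Ftwpsi m (f ord0), forall i, i != ord0 -> Ftwpsi 0 (f i)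
             & U = pure f]) T
  /\ forall s : 'S_n.+1, s ord0 = ord0 -> tact s T = T.
End Centres.

Section AffineWreath.
Variables (k : comNzRingType) (F : frobData k) (n : nat).

Definition awGen : choiceType := ('I_n + tpow F n + 'S_n)%type.

Notation gX i := (freeGen k (inl (inl i) : awGen)).
Notation gF f := (freeGen k (inl (inr f) : awGen)).
Notation gS s := (freeGen k (inr s : awGen)).

(* rel_XX to rel_SM present the free product of the polynomial algebra, the
   tensor power of F and the group algebra of S_n.  The action tact is a left
   action for the composition of permutations from right to left, whereas
   MathComp composes from left to right: s s' is (s' * s)%g. *)
Inductive awRel : freeAlg k awGen -> Prop :=
| rel_XX (i j : 'I_n) : awRel (gX i * gX j - gX j * gX i)
| rel_Flin (a : k) (f g : tpow F n) : awRel (gF (a *: f + g) - (a *: gF f + gF g))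
| rel_F1 : awRel (gF (tone F n) - 1)
| rel_FM (f g : tpow F n) : awRel (gF (tmul f g) - gF f * gF g)
| rel_S1 : awRel (gS 1%g - 1)
| rel_SM (s s' : 'S_n) : awRel (gS (s' * s)%g - gS s * gS s')
| rel_FX (f : tpow F n) (i : 'I_n) : awRel (gF f * gX i - gX i * gF (tpsi i f))
| rel_SX0 (i i' j : 'I_n) : i' = i.+1 :> nat -> j != i -> j != i' ->
    awRel (gS (tperm i i') * gX j - gX j * gS (tperm i i'))
| rel_SX (i i' : 'I_n) : i' = i.+1 :> nat ->
    awRel (gS (tperm i i') * gX i
             - (gX i' * gS (tperm i i') - gF (tt_ F i i')))
| rel_SF (s : 'S_n) (f : tpow F n) : awRel (gS s * gF f - gF (tact s f) * gS s).

Definition AW : pzAlg k := quotAlg awRel.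

Definition awX (i : 'I_n) : AW := quotMap awRel (gX i).
Definition awF (f : tpow F n) : AW := quotMap awRel (gF f).
Definition awS (s : 'S_n) : AW := quotMap awRel (gS s).

Inductive awGenHom : nat -> bool -> AW -> Prop :=
| awhom_X i : awGenHom (fDelta F) false (awX i)
| awhom_F d p f : thom d p f -> awGenHom d p (awF f)
| awhom_S s : awGenHom 0 false (awS s).

Definition awHom : nat -> bool -> AW -> Prop := homGen awGenHom.

Definition awMon (al : 'I_n -> nat) : AW := \prod_(i < n) awX i ^+ al i.
End AffineWreath.

Section Cyclotomic.
Variables (k : comNzRingType) (F : frobData k) (n theta : nat).
Variables (e : nat -> nat) (C : nat -> nat -> tpow F n.+1).

Definition level : nat := (\sum_(1 <= m < theta.+1) m * e m)%N.

Definition chi : AW F n.+1 :=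
  \prod_(1 <= m < theta.+1) \prod_(j < e m) (awX F ord0 ^+ m - awF (C m j)).

Definition AWC : pzAlg k := quotAlg (fun a : AW F n.+1 => a = chi).

Definition awcMap (a : AW F n.+1) : AWC := quotMap _ a.

Definition awcHom (d : nat) (p : bool) (u : AWC) : Prop :=
  exists a, awHom d p a /\ u = awcMap a.

(* These conditions determine tr, since the elements to which it is applied
   span AWC. *)
Definition is_trC (tr : AWC -> k) : Prop :=
  scalar tr /\
  forall (al : 'I_n.+1 -> nat) (f : tpow F n.+1) (s : 'S_n.+1),
    (forall i, al i < level)%N ->
    tr (awcMap (awMon F al * awF f * awS F s)) =
      [forall i, al i == level.-1]%:R * ttr f * (s == 1%g)%:R.
End Cyclotomic.

(* Main.v *)
Require Import Defs.
From mathcomp Require Import all_boot all_order all_fingroup all_algebra.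
From mathcomp Require Import boolp.
From mathcomp.multinomials Require Import monalg.
Import GRing.Theory.
Local Open Scope ring_scope.

Set Implicit Arguments.
Unset Strict Implicit.
Unset Printing Implicit Defensive.

(** Write N for the number of tensor factors and d for the level.  The functional
tr_C has prescribed values on the monomials x^a f pi with all a_i < d, and its mere
existence carries most of the proof: once these monomials are known to span the
quotient, the form (u, v) |-> tr_C (u v) is unitriangular between them and a second
explicit family, so that they are linearly independent and the form is perfect.

Filter the algebra by the total degree in the x_i.  Up to terms of smaller total
degree, pi x_i = x_(pi i) pi ([S_X], [S_mon]).  The product chi expresses x_1^d, and by
conjugation each x_i^d, through terms of smaller total degree ([filt_Xd]); hence the
monomials with all a_i < d span, and rewriting in terms of them never raises the total
degree ([filt_reduce]).  Therefore tr_C vanishes below total degree N(d - 1)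
([tr_filt]), and in total degree N(d - 1) it only sees the leading part ([tr_top]).
The relations are homogeneous, so the rewriting takes place inside each piece of given
degree and parity; this yields the grading.

Let b* be the right dual basis of the tensor power.  Pairing x^a b pi with
pi'^-1 b'* x^(d-1-a'), where |a| <= |a'|, stays in total degree at most N(d - 1), where
only the diagonal survives ([gram]).  An algebra with two families paired in this way
is a graded Frobenius superalgebra with a Nakayama automorphism
([frobenius_of_gram], [nakayama_of_gram]), and that automorphism is determined on an
element u by the comparison of tr_C (u v) with tr_C (v u').

For u in the tensor power ([tr_F]) or in S_N ([tr_S]) this comparison only involves
leading terms.  For u = x_1 and v = x^a f pi it does so unless a = (d-1, ..., d-1).  In
that case M = (x_1 ... x_N)^(d-1) commutes with S_N ([S_mon_top]), because the canonical
element t satisfies psi_j (t_ij) = t_ji ([tpsi_tt]).  Hence v x_1 = pi x_1 M f', both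
traces come from the factor x_1 M, and modulo chi only the coefficient of x_1^(d-1) in
the expansion of x_1^d contributes; this coefficient is fixed by psi_1, which makes the
two traces equal ([tr_X0]).  Finally x_(i+1) = (s_i x_i + t) s_i with t fixed by psi on
all factors, so the value on x_1 determines the value on every x_i. *)

(** * Linear maps and homogeneous elements *)

Section ScalarFacts.
Variables (k : comNzRingType) (V : lmodType k) (f : V -> k).
Hypothesis hf : scalar f.

Lemma scalar_0 : f 0 = 0.
Proof.
have := hf (-1) 0 0.
by rewrite scaler0 addr0 mulN1r addNr.
Qed.
Lemma scalar_Z a u : f (a *: u) = a * f u.
Proof. by rewrite -[a *: u]addr0 hf scalar_0 addr0. Qed.
Lemma scalar_D u v : f (u + v) = f u + f v.
Proof. by rewrite -[u]scale1r hf mul1r scale1r. Qed.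
Lemma scalar_N u : f (- u) = - f u.
Proof. by rewrite -scaleN1r scalar_Z mulN1r. Qed.
Lemma scalar_B u v : f (u - v) = f u - f v.
Proof. by rewrite scalar_D scalar_N. Qed.
Lemma scalar_sum I r (P : pred I) (E : I -> V) :
  f (\sum_(i <- r | P i) E i) = \sum_(i <- r | P i) f (E i).
Proof. exact: (big_morph f scalar_D scalar_0). Qed.
End ScalarFacts.

Section LinearFacts.
Variables (k : comNzRingType) (V W : lmodType k) (f : V -> W).
Hypothesis hf : linear f.

Lemma lin_0 : f 0 = 0.
Proof.
have := hf (-1) 0 0.
by rewrite scaler0 addr0 scaleN1r addNr.
Qed.
Lemma lin_Z a u : f (a *: u) = a *: f u.
Proof. by rewrite -[a *: u]addr0 hf lin_0 addr0. Qed.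
Lemma lin_D u v : f (u + v) = f u + f v.
Proof. by rewrite -[u]scale1r hf !scale1r. Qed.
Lemma lin_sum I r (P : pred I) (E : I -> V) :
  f (\sum_(i <- r | P i) E i) = \sum_(i <- r | P i) f (E i).
Proof. exact: (big_morph f lin_D lin_0). Qed.
End LinearFacts.

Section AlgFacts.
Variables (k : comNzRingType) (A : pzAlg k).
Lemma algZl (a : k) (x y : A) : (a *: x) * y = a *: (x * y).
Proof. by rewrite !algZE mulrA. Qed.
Lemma algZr (a : k) (x y : A) : x * (a *: y) = a *: (x * y).
Proof. by rewrite !algZE mulrA -[x * _](@alg_central k A) mulrA. Qed.
End AlgFacts.

Section GradedFacts.
Variables (k : comNzRingType) (A : pzAlg k) (h : nat -> bool -> A -> Prop).
Hypothesis hh : graded_superalgebra h.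

Lemma hom_sum d p I (r : seq I) (P : pred I) (E : I -> A) :
  (forall i, P i -> h d p (E i)) -> h d p (\sum_(i <- r | P i) E i).
Proof.
move=> hE; elim/big_rec: _ => [|i x Pi hx]; first exact: gsa_zero.
by rewrite -[E i]scale1r; apply: gsa_lin => //; exact: hE.
Qed.
Lemma hom_Z d p a x : h d p x -> h d p (a *: x).
Proof. by move=> hx; rewrite -[_ *: _]addr0; apply: gsa_lin => //; apply: gsa_zero. Qed.

(** The sign conventions only constrain homogeneous arguments, so every identity with
signs is proved there and extended by this principle. *)
Lemma hom_ext (V : lmodType k) (f g : A -> V) :
  linear f -> linear g ->
  (forall d p x, h d p x -> f x = g x) -> f =1 g.
Proof.
move=> lf lg fg x; have [N [c [hc ->]]] := gsa_span hh x.
rewrite !(lin_sum lf, lin_sum lg); apply: eq_bigr => d _.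
rewrite !(lin_sum lf, lin_sum lg); apply: eq_bigr => p _.
exact: fg (hc _ _).
Qed.
Lemma hom_ext_scalar (f g : A -> k) :
  scalar f -> scalar g ->
  (forall d p x, h d p x -> f x = g x) -> f =1 g.
Proof.
move=> lf lg fg; exact: (@hom_ext k^o f g lf lg fg).
Qed.
End GradedFacts.

(** * The Frobenius superalgebra F *)

Section Frobenius.
Variables (k : comNzRingType) (F : frobData k).
Hypothesis hF : is_frobData F.

Notation tr := (fTr F).
Notation psi := (fPsi F).
Notation hom := (fHom F).
Notation bb := (fB F).
Notation bv := (fBv F).
Notation dg := (fDeg F).
Notation pr := (fPar F).

Let gF : graded_superalgebra hom := gf_graded (fd_frobenius hF).
Lemma tr_scalar : scalar tr.
Proof. exact: gf_linear (fd_frobenius hF). Qed.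
Lemma psi_linear : linear psi.
Proof. by case: (fd_nakayama hF). Qed.
Lemma psiM : {morph psi : x y / x * y}.
Proof. by case: (fd_nakayama hF) => _ [_ ]. Qed.
Lemma psi1 : psi 1 = 1.
Proof. by case: (fd_nakayama hF) => _ [ ]. Qed.
Lemma psi_tr d e p q f g : hom d p f -> hom e q g ->
  tr (f * g) = (-1) ^+ (p && q) * tr (g * psi f).
Proof. by case: (fd_nakayama hF) => _ _ _; apply. Qed.

Definition coef (b : fIdx F) (f : F) : k := tr (bv b * f).

Lemma coef_scalar b : scalar (coef b).
Proof. by move=> a u v; rewrite /coef mulrDr algZr tr_scalar. Qed.

Lemma coef_fB b c : coef b (bb c) = (b == c)%:R.
Proof. exact: fd_dual. Qed.

Lemma coef_expand f : f = \sum_b coef b f *: bb b.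
Proof.
have [c [E _]] := fd_basis hF f.
rewrite {1}E; apply: eq_bigr => b _; congr (_ *: _).
rewrite E (scalar_sum (coef_scalar b)) (bigD1 b) //= (scalar_Z (coef_scalar b)) coef_fB eqxx mulr1.
rewrite big1 ?addr0 // => a ne; rewrite (scalar_Z (coef_scalar b)) coef_fB.
by rewrite eq_sym (negbTE ne) mulr0.
Qed.

Lemma coef_inj f g : (forall b, coef b f = coef b g) -> f = g.
Proof.
move=> E; rewrite [f]coef_expand [g]coef_expand.
by apply: eq_bigr => b _; rewrite E.
Qed.

Lemma fB_hom b : hom (dg b) (pr b) (bb b).
Proof. exact: fd_homogeneous. Qed.

Lemma hom_of_coef d p f :
  (forall b, coef b f <> 0 -> dg b = d /\ pr b = p) -> hom d p f.
Proof.
move=> H; rewrite [f]coef_expand; apply: hom_sum => // b _.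
have [->|/eqP ne] := eqVneq (coef b f) 0; first by rewrite scale0r; apply: gsa_zero.
by have [<- <-] := H b ne; apply: hom_Z => //; exact: fB_hom.
Qed.

(** Each basis element is homogeneous, so grouping the expansion of f by degree and
parity writes 0 as a sum of homogeneous elements, and the sum is direct. *)
Lemma coef_of_hom d p f b : hom d p f -> coef b f <> 0 -> dg b = d /\ pr b = p.
Proof.
move=> hf ne.
(* the homogeneous parts of the expansion of f, minus f itself *)
pose c e q := \sum_(a | (dg a == e) && (pr a == q)) coef a f *: bb a
              - ((e == d) && (q == p))%:R *: f.
have hc e q : hom e q (c e q).
  rewrite /c -scaleN1r addrC; apply: gsa_lin => //.
    by have [/andP[/eqP-> /eqP->]|_] := boolP (_ && _);
      [apply: hom_Z | rewrite scale0r; apply: gsa_zero].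
  apply: hom_sum => // a /andP[/eqP<- /eqP<-]; apply: hom_Z => //; exact: fB_hom.
pose N := (d + \max_a dg a).+1.
have ltN a : (dg a < N)%N.
  by rewrite ltnS (leq_trans _ (leq_addl _ _)) // leq_bigmax.
have s0 : \sum_(e < N) \sum_(q : bool) c e q = 0.
  rewrite /c; under eq_bigr do rewrite big_split /=.
  rewrite big_split /=; apply/eqP; rewrite addr_eq0; apply/eqP.
  have dN : (d < N)%N by rewrite ltnS leq_addr.
  rewrite [in RHS](bigD1 (Ordinal dN)) //= [X in _ = - (_ + X)]big1 => [|e ne']; last first.
    rewrite big1 // => q _; rewrite (_ : (e == d :> nat) = false) ?scale0r ?oppr0 //.
    by apply: contraNF ne' => /eqP E; apply/eqP/val_inj.
  rewrite [in RHS](bigD1 p) //= !eqxx /= [X in _ = - (_ + X + _)]big1 => [|q ne']; last first.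
    by rewrite (negbTE ne') scale0r oppr0.
  rewrite !addr0 scale1r opprK.
  rewrite [RHS]coef_expand pair_big /=.
  by rewrite [RHS](partition_big (fun a => (Ordinal (ltN a), pr a)) xpredT).
have := gsa_indep gF hc s0 (pr b) (ltN b).
case: (boolP ((dg b == d) && (pr b == p))) => [/andP[/eqP-> /eqP->] //|nE].
rewrite /c (negbTE nE) scale0r subr0 => /(congr1 (coef b)).
rewrite (scalar_sum (coef_scalar b)) (bigD1 b) ?eqxx //=.
rewrite (scalar_Z (coef_scalar b)) coef_fB eqxx mulr1 big1 ?addr0 => [|a /andP[_ ne']].
  by rewrite (scalar_0 (coef_scalar b)) => /ne.
by rewrite (scalar_Z (coef_scalar b)) coef_fB eq_sym (negbTE ne') mulr0.
Qed.

Lemma tr_parity d p f : hom d p f -> tr f <> 0 -> p = false.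
Proof. by case: p => // hf; rewrite (gf_even (fd_frobenius hF) hf). Qed.

(** The degree of the trace is the maximal degree: it is the degree of a nonzero
element, since tr does not vanish, and a nonzero element of maximal degree pairs
nontrivially with something, whose degree can only add to it. *)
Lemma tr_degree d p f : hom d p f -> tr f <> 0 -> d = fDelta F.
Proof.
have [D hD] := gf_homogeneous (fd_frobenius hF).
have trD e q g : hom e q g -> tr g <> 0 -> e = D.
  by move=> hg; have [//|/eqP ne] := eqVneq e D; rewrite (hD _ _ _ hg ne).
suff -> : fDelta F = D by exact: trD.
have [[q [a [ha na]]] hmax] := fd_delta hF.
have exb : exists b, coef b a <> 0.
  apply/not_existsP => H; apply: na; apply: coef_inj => b.
  by rewrite (scalar_0 (coef_scalar b)); apply: contrapT; apply: H.
have [b nb] := exb.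
have [N [c [hc E]]] := gsa_span gF (bv b).
apply/eqP; rewrite eqn_leq; apply/andP; split.
  have : exists e q, tr (c e q * a) <> 0.
    apply/not_existsP => H; apply: nb; rewrite /coef E mulr_suml.
    rewrite (scalar_sum tr_scalar) big1 // => e _; rewrite mulr_suml.
    rewrite (scalar_sum tr_scalar) big1 // => r _.
    by apply: contrapT => ne; apply: (H e); exists r.
  move=> [e [r ne]]; rewrite -(trD _ _ _ (gsa_mul gF (hc e r) ha) ne).
  exact: leq_addl.
have nz : exists e q, tr (c e q * bb b) <> 0.
  apply/not_existsP => H.
  have : tr (bv b * bb b) = 0.
    rewrite E mulr_suml (scalar_sum tr_scalar) big1 // => e _; rewrite mulr_suml.
    rewrite (scalar_sum tr_scalar) big1 // => r _.
    by apply: contrapT => ne; apply: (H e); exists r.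
  by rewrite (fd_dual hF) eqxx => /eqP; rewrite oner_eq0.
move: nz => [e [r ne]].
have hm := gsa_mul gF (hc e r) (fB_hom b).
rewrite -(trD _ _ _ hm ne) leqNgt; apply/negP => lt.
by apply: ne; rewrite (hmax _ _ _ hm lt) (scalar_0 tr_scalar).
Qed.

Lemma tr_nz d e p q f g : hom d p f -> hom e q g -> tr (f * g) <> 0 ->
  (d + e)%N = fDelta F /\ p = q.
Proof.
move=> hf hg ne; have hm := gsa_mul gF hf hg.
split; first exact: tr_degree hm ne.
by have := tr_parity hm ne; case: p q {hf hg hm} => [] [].
Qed.

(** Perfectness is given for the form with a Koszul sign and with f on the right.  An
element r whose signed pairing is the coordinate functional of b, with its odd part
negated, satisfies tr (f r') = coef b f, and the hypothesis kills the left side. *)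
Lemma tr_left_nondeg f : (forall b, tr (f * bb b) = 0) -> f = 0.
Proof.
move=> H; apply: coef_inj => b.
rewrite (scalar_0 (coef_scalar b)).
have [Phi [_ PhiL PhiE PhiU]] := gf_iso (fd_frobenius hF).
have [r [hr _]] := PhiU _ (coef_scalar b).
have [N [c [hc E]]] := gsa_span gF r.
pose r' := \sum_(d < N) \sum_(p : bool) (-1) ^+ p *: c d p.
have -> : coef b f = tr (f * r').
  suff : coef b =1 (fun g => tr (g * r')) by move->.
  apply: (hom_ext_scalar gF).
  - exact: coef_scalar.
  - by move=> a u v; rewrite mulrDl algZl tr_scalar.
  move=> d p g hg; rewrite -hr E /r' mulr_sumr (scalar_sum (PhiL g)) (scalar_sum tr_scalar).
  apply: eq_bigr => e _; rewrite mulr_sumr (scalar_sum (PhiL g)) (scalar_sum tr_scalar).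
  apply: eq_bigr => q _; rewrite algZr (scalar_Z tr_scalar) (PhiE _ _ _ _ _ _ (hc e q) hg).
  have [->|/eqP ne] := eqVneq (tr (g * c e q)) 0; first by rewrite !mulr0.
  by have [_ ->] := tr_nz hg (hc e q) ne; rewrite andbb.
rewrite [r']coef_expand mulr_sumr (scalar_sum tr_scalar) big1 // => a _.
by rewrite algZr (scalar_Z tr_scalar) H mulr0.
Qed.

(** The trace of b^v c depends only on the part of b^v of complementary degree and equal
parity, and that part satisfies the same duality relations. *)
Lemma dual_hom b : exists2 d, hom d (pr b) (bv b) & (d + dg b)%N = fDelta F.
Proof.
(* y is the part of b^v of complementary degree and equal parity *)
pose sel a := ((dg a + dg b)%N == fDelta F) && (pr a == pr b).
pose y := \sum_(a | sel a) coef a (bv b) *: bb a.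
have E : bv b = y.
  apply/eqP; rewrite -subr_eq0; apply/eqP/tr_left_nondeg => c.
  rewrite mulrBl (scalar_B tr_scalar); apply/eqP; rewrite subr_eq0; apply/eqP.
  rewrite /y mulr_suml (scalar_sum tr_scalar).
  have -> : \sum_(a | sel a) tr ((coef a (bv b) *: bb a) * bb c)
    = \sum_(a | sel a) coef a (bv b) * tr (bb a * bb c).
    by apply: eq_bigr => a _; rewrite algZl (scalar_Z tr_scalar).
  have E0 : tr (bv b * bb c) = \sum_a coef a (bv b) * tr (bb a * bb c).
    rewrite [bv b in LHS]coef_expand mulr_suml (scalar_sum tr_scalar).
    by apply: eq_bigr => a _; rewrite algZl (scalar_Z tr_scalar).
  have nzE a : tr (bb a * bb c) <> 0 -> (dg a + dg c)%N = fDelta F /\ pr a = pr c.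
    exact: tr_nz (fB_hom a) (fB_hom c).
  case: (boolP ((dg c == dg b) && (pr c == pr b))) => [/andP[/eqP Ed /eqP Ep]|ncb].
    rewrite E0 (bigID sel) /= [X in _ + X]big1 ?addr0 // => a nsel.
    have [->|/eqP ne] := eqVneq (tr (bb a * bb c)) 0; first by rewrite mulr0.
    by have [E1 E2] := nzE a ne; move: nsel; rewrite /sel -Ed -Ep E1 E2 !eqxx.
  rewrite (fd_dual hF) (_ : (b == c) = false); last first.
    by apply: contraNF ncb => /eqP->; rewrite !eqxx.
  rewrite big1 // => a /andP[/eqP s1 /eqP s2].
  have [->|/eqP ne] := eqVneq (tr (bb a * bb c)) 0; first by rewrite mulr0.
  have [E1 E2] := nzE a ne; move: ncb.
  by rewrite -E2 s2 eqxx andbT -(inj_eq (@addnI (dg a))) E1 s1 eqxx.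
have le : (dg b <= fDelta F)%N.
  rewrite leqNgt; apply/negP => lt.
  have : tr (bv b * bb b) = 0.
    rewrite E /y big1 ?mul0r ?(scalar_0 tr_scalar) // => a /andP[/eqP s1 _].
    by move: lt; rewrite -s1 ltnNge leq_addl.
  by rewrite (fd_dual hF) eqxx => /eqP; rewrite oner_eq0.
exists (fDelta F - dg b)%N; last by rewrite subnK.
rewrite E; apply: hom_sum => // a /andP[/eqP s1 /eqP s2]; apply: hom_Z => //.
by rewrite -s1 addnK -s2; exact: fB_hom.
Qed.

(** By the Nakayama relation the coordinates of psi f are, up to sign, the traces
tr (f b^v), which see the degree and the parity of f. *)
Lemma psi_hom d p f : hom d p f -> hom d p (psi f).
Proof.
move=> hf; apply: hom_of_coef => b; have [e hb E] := dual_hom b.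
rewrite /coef => ne.
have ne' : tr (f * bv b) <> 0.
  by rewrite (psi_tr hf hb); move=> /(congr1 ( *%R ((-1) ^+ (p && pr b))));
    rewrite mulrA -signr_addb addbb expr0 mul1r mulr0.
have [E1 E2] := tr_nz hf hb ne'; split=> //.
by apply/eqP; rewrite -(inj_eq (@addnI e)) E [(e + d)%N]addnC E1.
Qed.

Lemma iter_psi_hom m d p f : hom d p f -> hom d p (iter m psi f).
Proof. by move=> hf; elim: m => //= m; apply: psi_hom. Qed.

Lemma iter_psi_linear m : linear (iter m psi).
Proof. by elim: m => [|m IH] a u v //=; rewrite IH psi_linear. Qed.

Lemma iter_psiM m : {morph iter m psi : x y / x * y}.
Proof. by elim: m => [|m IH] x y //=; rewrite IH psiM. Qed.

Lemma tr_psi f : tr (psi f) = tr f.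
Proof.
apply: (@hom_ext_scalar _ _ _ gF (fun f => tr (psi f)) tr) => [a u v|a u v|d p g hg].
- by rewrite psi_linear tr_scalar.
- by rewrite tr_scalar.
by rewrite -[in RHS](mulr1 g) (psi_tr hg (gsa_one gF)) andbF mul1r mul1r.
Qed.

Lemma tr_iter_psi m f : tr (iter m psi f) = tr f.
Proof. by elim: m => //= m IH; rewrite tr_psi. Qed.

(** The symmetry of the canonical element sum_b b (x) b^v under exchange of its factors
and psi, read on the coordinates of the b^v; see [tpsi_tt]. *)
Lemma coef_psi_dual a c :
  coef c (psi (bv a)) = (-1) ^+ pr a * coef a (bv c).
Proof.
have [d ha _] := dual_hom a; have [e hc _] := dual_hom c.
rewrite /coef (psi_tr ha hc) mulrA.
have [->|/eqP ne] := eqVneq (tr (bv c * psi (bv a))) 0; first by rewrite mulr0.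
by have [_ ->] := tr_nz hc (psi_hom ha) ne; rewrite andbb -signr_addb addbb expr0 mul1r.
Qed.

(** Up to sign, the psi (b^v) form the right dual basis of F. *)
Lemma tr_right_dual b c : tr (bb c * psi (bv b)) = (-1) ^+ pr b * (b == c)%:R.
Proof.
have [d hb _] := dual_hom b.
rewrite -(fd_dual hF) (psi_tr hb (fB_hom c)) mulrA.
have [->|/eqP ne] := eqVneq (tr (bb c * psi (bv b))) 0; first by rewrite mulr0.
by have [_ ->] := tr_nz (fB_hom c) (psi_hom hb) ne; rewrite andbb -signr_addb addbb expr0 mul1r.
Qed.
End Frobenius.

(** * Tensor powers of F *)

Section Tensor.
Variables (k : comNzRingType) (F : frobData k) (N : nat).
Hypothesis hF : is_frobData F.

Notation tr := (fTr F).
Notation psi := (fPsi F).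
Notation hom := (fHom F).
Notation bb := (fB F).
Notation bv := (fBv F).
Notation dg := (fDeg F).
Notation pr := (fPar F).
Notation T := (tpow F N).
Notation idx := (tidx F N).
Implicit Types (b : idx) (f g : 'I_N -> F).

Let gF : graded_superalgebra hom := gf_graded (fd_frobenius hF).

Definition tbasis b : T := pure (fun i => bb (b i)).

Lemma pureE f b : pure f b = \prod_i coef (b i) (f i).
Proof. by rewrite ffunE. Qed.

Lemma tbasisE b c : tbasis b c = (b == c)%:R.
Proof.
rewrite pureE; under eq_bigr do rewrite (coef_fB hF).
have [->|/eqP ne] := eqVneq b c; first by rewrite big1 // => i _; rewrite eqxx.
have [i ni] : exists i, c i != b i.
  apply/existsP; rewrite -negb_forall; apply: contra_notN ne => /forallP H.
  by apply/ffunP => i; rewrite (eqP (H i)).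
by rewrite (bigD1 i) //= (negbTE ni) mul0r.
Qed.

Lemma tpow_expand (U : T) : U = \sum_b U b *: tbasis b.
Proof.
apply/ffunP => c; rewrite sum_ffunE (bigD1 c) //= ffunE tbasisE eqxx.
rewrite [_ *: _]mulr1 big1 ?addr0 // => b ne.
by rewrite ffunE tbasisE (negbTE ne) [_ *: _]mulr0.
Qed.

(** All operations on the tensor power are linear, so identities are checked on pure
tensors of basis elements, whose factors are homogeneous. *)
Lemma tpow_ext (V : lmodType k) (G H : T -> V) : linear G -> linear H ->
  (forall b, G (tbasis b) = H (tbasis b)) -> G =1 H.
Proof.
move=> lG lH E U; rewrite [U]tpow_expand !(lin_sum lG, lin_sum lH).
by apply: eq_bigr => b _; rewrite (lin_Z lG) (lin_Z lH) E.
Qed.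

Lemma pure_ext f g : f =1 g -> pure f = pure g :> T.
Proof. by move=> E; apply/ffunP => b; rewrite !pureE; apply: eq_bigr => i _; rewrite E. Qed.

Lemma pure_multilinear (I : finType) (x : 'I_N -> I -> k) (g : 'I_N -> I -> F) :
  pure (fun i => \sum_a x i a *: g i a)
  = \sum_(a : {ffun 'I_N -> I}) (\prod_i x i (a i)) *: pure (fun i => g i (a i)) :> T.
Proof.
apply/ffunP => b; rewrite pureE sum_ffunE.
under eq_bigr => i _ do rewrite (scalar_sum (coef_scalar hF (b i))).
rewrite bigA_distr_bigA /=; apply: eq_bigr => a _.
rewrite ffunE pureE [RHS]/(_ *: _) /= -big_split /=.
by apply: eq_bigr => i _; rewrite (scalar_Z (coef_scalar hF _)).
Qed.

Lemma pure_nz (d : 'I_N -> nat) (p : 'I_N -> bool) f b : (forall i, hom (d i) (p i) (f i)) ->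
  pure f b <> 0 -> forall i, dg (b i) = d i /\ pr (b i) = p i.
Proof.
move=> hf ne i; apply: (coef_of_hom hF (hf i)) => E; apply: ne.
by rewrite pureE (bigD1 i) //= E mul0r.
Qed.

Lemma tbasis_hom b i : hom (dg (b i)) (pr (b i)) (bb (b i)).
Proof. exact: fB_hom. Qed.

Lemma tmap_linear (phi : 'I_N -> F -> F) : linear (@tmap _ F N phi).
Proof.
move=> x U V; rewrite /tmap scaler_sumr -big_split /=; apply: eq_bigr => a _.
by rewrite !ffunE scalerDl scalerA.
Qed.

Lemma tmap_pure (phi : 'I_N -> F -> F) f : (forall i, linear (phi i)) ->
  tmap phi (pure f) = pure (fun i => phi i (f i)).
Proof.
move=> lphi; rewrite /tmap; under eq_bigr do rewrite pureE.
rewrite -(pure_multilinear (fun i a => coef a (f i)) (fun i a => phi i (bb a))).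
apply: pure_ext => i; rewrite [f i in RHS](coef_expand hF) (lin_sum (lphi i)).
by apply: eq_bigr => a _; rewrite (lin_Z (lphi i)).
Qed.

Lemma tmap_ext (phi phi' : 'I_N -> F -> F) : (forall i, phi i =1 phi' i) ->
  tmap phi =1 tmap phi'.
Proof. by move=> E U; apply: eq_bigr => a _; congr (_ *: _); apply: pure_ext => i; apply: E. Qed.

Lemma tmap_comp (phi phi' : 'I_N -> F -> F) U : (forall i, linear (phi i)) ->
  (forall i, linear (phi' i)) ->
  tmap phi (tmap phi' U) = tmap (fun i => phi i \o phi' i) U.
Proof.
move=> l l'; rewrite {2 3}/tmap (lin_sum (tmap_linear phi)); apply: eq_bigr => a _.
by rewrite (lin_Z (tmap_linear phi)) tmap_pure.
Qed.

Lemma tmap_id (phi : 'I_N -> F -> F) U : (forall i, phi i =1 id) -> tmap phi U = U.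
Proof.
move=> E; rewrite [RHS]tpow_expand; apply: eq_bigr => a _; congr (_ *: _).
by apply: pure_ext => i; rewrite E.
Qed.

(** The Koszul sign of (f_1 (x) ... )(g_1 (x) ...) for f_i of parity p i and g_j of parity
q j. *)
Definition msign (p q : 'I_N -> bool) : k :=
  (-1) ^+ (\sum_(i < N) \sum_(j < N | (j < i)%N) (p i && q j))%N.

Lemma tmul_linl U : linear (fun V : T => tmul V U).
Proof.
move=> x V W; rewrite /tmul scaler_sumr -big_split /=; apply: eq_bigr => a _.
rewrite scaler_sumr -big_split /=; apply: eq_bigr => c _.
rewrite !ffunE scalerA -scalerDl (_ : x *: V a + W a = x * V a + W a :> k) //.
by rewrite !mulrDl !mulrA.
Qed.

Lemma tmul_linr U : linear (fun V : T => tmul U V).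
Proof.
move=> x V W; rewrite /tmul scaler_sumr -big_split /=; apply: eq_bigr => a _.
rewrite scaler_sumr -big_split /=; apply: eq_bigr => c _.
rewrite !ffunE scalerA -scalerDl (_ : x *: V c + W c = x * V c + W c :> k) //.
congr (_ *: _).
by rewrite mulrDr mulrDl !mulrA [U a * x]mulrC.
Qed.

(** In the expansion of both pure tensors only basis tensors with the parities of the
factors occur, so all terms carry the same sign; what remains is multilinearity. *)
Lemma tmul_pure (d e : 'I_N -> nat) (p q : 'I_N -> bool) f g :
  (forall i, hom (d i) (p i) (f i)) -> (forall i, hom (e i) (q i) (g i)) ->
  tmul (pure f) (pure g) = msign p q *: pure (fun i => f i * g i) :> T.
Proof.
move=> hf hg.
pose G (i : 'I_N) (u : fIdx F * fIdx F) : F := bb u.1 * bb u.2.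
pose X i (u : fIdx F * fIdx F) := coef u.1 (f i) * coef u.2 (g i).
have -> : pure (fun i => f i * g i) = pure (fun i => \sum_u X i u *: G i u) :> T.
  apply: pure_ext => i; rewrite {1}(coef_expand hF (f i)) {1}(coef_expand hF (g i)).
  rewrite mulr_suml -(pair_bigA _ (fun a c => X i (a, c) *: G i (a, c))) /=.
  apply: eq_bigr => a _; rewrite mulr_sumr; apply: eq_bigr => c _.
  by rewrite algZl algZr scalerA.
rewrite pure_multilinear /tmul pair_bigA /= scaler_sumr.
(* pairs of index families correspond to families of pairs *)
pose h (u : idx * idx) : {ffun 'I_N -> fIdx F * fIdx F} := [ffun i => (u.1 i, u.2 i)].
pose h' (v : {ffun 'I_N -> fIdx F * fIdx F}) : idx * idx :=
  ([ffun i => (v i).1], [ffun i => (v i).2]).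
rewrite [RHS](reindex h) /=; last first.
  exists h' => [[a c] _|v _]; rewrite /h /h' /=; last first.
    by apply/ffunP => i; rewrite !ffunE; case: (v i).
  by congr (_, _); apply/ffunP => i; rewrite !ffunE.
apply: eq_bigr => -[a c] _ /=.
have E : \prod_i X i (h (a, c) i) = pure f a * pure g c.
  by rewrite !pureE -big_split; apply: eq_bigr => i _; rewrite /X /h ffunE.
rewrite E scalerA.
have -> : pure (fun i => G i (h (a, c) i)) = pure (fun i => bb (a i) * bb (c i)) :> T.
  by apply: pure_ext => i; rewrite /h ffunE.
congr (_ *: _).
have [->|/eqP na] := eqVneq (pure f a) 0; first by rewrite !mul0r mulr0.
have [->|/eqP nc] := eqVneq (pure g c) 0; first by rewrite !mulr0 mul0r.
have pa := pure_nz hf na; have pc := pure_nz hg nc.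
rewrite mulrC; congr (_ ^+ _ * _); apply: eq_bigr => i _; apply: eq_bigr => j _.
by have [_ ->] := pa i; have [_ ->] := pc j.
Qed.

Lemma ttr_scalar : scalar (@ttr _ F N).
Proof.
move=> x U V; rewrite /ttr mulr_sumr -big_split; apply: eq_bigr => a _.
by rewrite !ffunE mulrDl -mulrA.
Qed.

Lemma ttr_pure f : ttr (pure f : T) = \prod_i tr (f i).
Proof.
have -> : ttr (pure f : T) = \sum_(a : idx) \prod_i (coef (a i) (f i) * tr (bb (a i))) :> k.
  by apply: eq_bigr => a _; rewrite pureE big_split.
rewrite -(bigA_distr_bigA (fun i a => coef a (f i) * tr (bb a))) /=.
apply: eq_bigr => i _; rewrite [in RHS](coef_expand hF (f i)) (scalar_sum (tr_scalar hF)).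
by apply: eq_bigr => a _; rewrite (scalar_Z (tr_scalar hF)).
Qed.

Lemma ttr_tmap (phi : 'I_N -> F -> F) U : (forall i, linear (phi i)) ->
  (forall i (u : F), tr (phi i u) = tr u) -> ttr (tmap phi U) = ttr U.
Proof.
move=> l E; rewrite {2}/ttr /tmap (scalar_sum ttr_scalar).
apply: eq_bigr => a _; rewrite (scalar_Z ttr_scalar) ttr_pure.
by congr (_ * _); apply: eq_bigr => i _; rewrite E.
Qed.

Lemma tact_linear s : linear (@tact _ F N s).
Proof.
move=> x U V; apply/ffunP => b; rewrite !ffunE.
by rewrite mulrDr [_ *: _]/(_ * _) mulrCA.
Qed.

(** The sign of permuting homogeneous factors of parities p i; [aperm j s] is s j. *)
Definition psign (s : 'S_N) (p : 'I_N -> bool) : k :=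
  (-1) ^+ (\sum_(i < N) \sum_(j < N | (i < j)%N && (aperm j s < aperm i s)%N) (p i && p j))%N.

Lemma tact_pure (s : 'S_N) (d : 'I_N -> nat) (p : 'I_N -> bool) f :
  (forall i, hom (d i) (p i) (f i)) ->
  tact s (pure f) = psign s p *: pure (fun i => f (s^-1 i)%g) :> T.
Proof.
move=> hf; apply/ffunP => b; rewrite !ffunE -/(pure f).
have -> : \prod_i tr (bv (b i) * f ((s^-1)%g i)) = pure f [ffun i => b (s i)].
  rewrite pureE (reindex_inj (@perm_inj _ s)); apply: eq_bigr => i _.
  by rewrite permK ffunE.
have -> : \prod_i tr (bv ([ffun i0 => b (s i0)] i) * f i) = pure f [ffun i => b (s i)].
  by rewrite pureE.
have [->|/eqP ne] := eqVneq (pure f [ffun i => b (s i)]) 0; first by rewrite scaler0 mulr0.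
have pe := pure_nz hf ne; congr (_ ^+ _ * _); apply: eq_bigr => i _; apply: eq_bigr => j _.
by have [_ <-] := pe i; have [_ <-] := pe j; rewrite !ffunE.
Qed.

(** Signs only arise from odd factors, and the trace of an odd factor is zero. *)
Lemma ttr_tact s U : ttr (tact s U : T) = ttr U.
Proof.
apply: (@tpow_ext k^o (fun U => ttr (tact s U)) (@ttr _ F N)) => [x V W|x V W|b].
- by rewrite tact_linear ttr_scalar.
- by rewrite ttr_scalar.
rewrite /tbasis (tact_pure s (tbasis_hom b)) (scalar_Z ttr_scalar) !ttr_pure.
rewrite (reindex_inj (@perm_inj _ s)) /=; under eq_bigr do rewrite permK.
have [->|/eqP ne] := eqVneq (\prod_i tr (bb (b i))) 0; first by rewrite mulr0.
have pe i : pr (b i) = false.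
  apply: (tr_parity hF (fB_hom hF (b i))) => E; apply: ne.
  by rewrite (bigD1 i) //= E mul0r.
rewrite /psign big1 ?expr0 ?mul1r // => i _; rewrite big1 // => j _.
by rewrite pe.
Qed.

Lemma thom_pure (d : 'I_N -> nat) (p : 'I_N -> bool) f : (forall i, hom (d i) (p i) (f i)) ->
  thom (\sum_i d i)%N (odd (\sum_i p i)) (pure f : T).
Proof.
move=> hf b ne; have pe := pure_nz hf ne.
split; last congr (odd _); apply: eq_bigr => i _; have [E1 E2] := pe i.
  exact: E1.
by rewrite E2.
Qed.

Lemma thom_lin d p x (U V : T) : thom d p U -> thom d p V -> thom d p (x *: U + V).
Proof.
move=> hU hV b; rewrite !ffunE => ne.
have [E|/eqP /hU //] := eqVneq (U b) 0.
by apply: hV => E'; apply: ne; rewrite E E' scaler0 addr0.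
Qed.

Lemma thom0 d p : thom d p (0 : T).
Proof. by move=> b; rewrite ffunE. Qed.

Lemma thomZ d p x (U : T) : thom d p U -> thom d p (x *: U).
Proof. by move=> h; rewrite -[_ *: _]addr0; apply: thom_lin => //; exact: thom0. Qed.

Lemma thom_sum d p I (r : seq I) (P : pred I) (E : I -> T) :
  (forall i, P i -> thom d p (E i)) -> thom d p (\sum_(i <- r | P i) E i).
Proof.
move=> H; elim/big_rec: _ => [|i x Pi hx]; first exact: thom0.
by rewrite -[E i]scale1r; apply: thom_lin => //; exact: H.
Qed.

Lemma thom_tbasis b : thom (\sum_i dg (b i)) (odd (\sum_i pr (b i))) (tbasis b).
Proof. exact: thom_pure (tbasis_hom b). Qed.

(** A homogeneous tensor only involves basis tensors of the same degree and parity. *)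
Lemma thom_ind d p (U : T) (Q : T -> Prop) : thom d p U -> Q 0 ->
  (forall x V W, Q V -> Q W -> Q (x *: V + W)) ->
  (forall b, (\sum_i dg (b i))%N = d -> odd (\sum_i pr (b i)) = p -> Q (tbasis b)) -> Q U.
Proof.
move=> hU Q0 Qlin Qb; rewrite [U]tpow_expand; elim/big_rec: _ => // b V _ QV.
have [E|/eqP ne] := eqVneq (U b) 0; first by rewrite E scale0r add0r.
by have [? ?] := hU b ne; apply: Qlin => //; apply: Qb.
Qed.

Lemma thom_one : thom 0 false (tone F N).
Proof.
have := @thom_pure (fun _ => 0%N) (fun _ => false) (fun _ => 1) (fun _ => gsa_one gF).
by rewrite !big1.
Qed.

Lemma odd_sum (p q : 'I_N -> bool) :
  odd (\sum_i (p i (+) q i)) = odd (\sum_i p i) (+) odd (\sum_i q i).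
Proof.
rewrite -oddD -big_split /= !(big_morph odd oddD (erefl _)).
by apply: eq_bigr => i _; case: (p i) (q i) => [] [].
Qed.

Lemma thom_mul d e p q (U V : T) : thom d p U -> thom e q V ->
  thom (d + e) (p (+) q) (tmul U V).
Proof.
move=> hU hV; apply: (thom_ind (Q := fun U => thom _ _ (tmul U V)) hU) => [|x W W' h h'|b <- <-].
- by rewrite (lin_0 (tmul_linl V)); apply: thom0.
- by rewrite (tmul_linl V); apply: thom_lin.
apply: (thom_ind (Q := fun V => thom _ _ (tmul _ V)) hV) => [|x W W' h h'|c <- <-].
- by rewrite (lin_0 (tmul_linr _)); apply: thom0.
- by rewrite (tmul_linr _); apply: thom_lin.
rewrite /tbasis (tmul_pure (tbasis_hom b) (tbasis_hom c)); apply: thomZ.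
rewrite -big_split -odd_sum; apply: thom_pure => i.
by apply: gsa_mul => //; apply: tbasis_hom.
Qed.

Lemma thom_tmap (phi : 'I_N -> F -> F) d p U :
  (forall i e (r : bool) (u : F), hom e r u -> hom e r (phi i u)) ->
  thom d p U -> thom d p (tmap phi U).
Proof.
move=> hphi hU; apply: thom_sum => a _.
have [->|/eqP ne] := eqVneq (U a) 0; first by rewrite scale0r; apply: thom0.
apply: thomZ; have [<- <-] := hU a ne; apply: thom_pure => i.
by apply: hphi; apply: tbasis_hom.
Qed.

Lemma thom_tact s d p (U : T) : thom d p U -> thom d p (tact s U).
Proof.
move=> hU b; rewrite ffunE => ne.
have ne' : U [ffun i => b (s i)] <> 0 by move=> E; apply: ne; rewrite E mulr0.
have [<- <-] := hU _ ne'; rewrite (reindex_inj (@perm_inj _ s)).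
rewrite [X in odd X](reindex_inj (@perm_inj _ s)).
by split; last congr (odd _); apply: eq_bigr => i _; rewrite ffunE.
Qed.

Lemma tmap_mul (phi : 'I_N -> F -> F) (U V : T) :
  (forall i, linear (phi i)) -> (forall i, {morph phi i : x y / x * y}) ->
  (forall i e (r : bool) (u : F), hom e r u -> hom e r (phi i u)) ->
  tmap phi (tmul U V) = tmul (tmap phi U) (tmap phi V).
Proof.
move=> l m h.
pose G V U := tmap phi (tmul U V); pose H V U := tmul (tmap phi U) (tmap phi V).
change (G V U = H V U).
apply: tpow_ext => [x A B|x A B|a].
- by rewrite /G tmul_linl tmap_linear.
- by rewrite /H tmap_linear tmul_linl.
apply: (@tpow_ext _ (fun V => G V _) (fun V => H V _)) => [x A B|x A B|c].
- by rewrite /G tmul_linr tmap_linear.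
- by rewrite /H tmap_linear tmul_linr.
rewrite /G /H /tbasis !tmap_pure // (tmul_pure (tbasis_hom a) (tbasis_hom c)).
rewrite (lin_Z (tmap_linear _)) tmap_pure //.
rewrite (tmul_pure (d := fun i => dg (a i)) (e := fun i => dg (c i))
  (p := fun i => pr (a i)) (q := fun i => pr (c i))) => [|i|i].
- by congr (_ *: _); apply: pure_ext => i; rewrite m.
- by apply: h; apply: tbasis_hom.
- by apply: h; apply: tbasis_hom.
Qed.

(** This is psi_1^(al 1) ... psi_N^(al N), which appears when f is moved across x^al. *)
Definition tpsi_pow (al : 'I_N -> nat) : T -> T := tmap (fun i => iter (al i) psi).

Lemma tpsi_linear j : linear (@tpsi _ F N j).
Proof. exact: tmap_linear. Qed.

Lemma tpsi_pow_linear al : linear (tpsi_pow al).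
Proof. exact: tmap_linear. Qed.

Lemma tpsi_pow_pure al f : tpsi_pow al (pure f) = pure (fun i => iter (al i) psi (f i)).
Proof. by apply: tmap_pure => i; apply: iter_psi_linear. Qed.

Lemma tpsi_powD al be U : tpsi_pow al (tpsi_pow be U) = tpsi_pow (fun i => al i + be i)%N U.
Proof.
rewrite /tpsi_pow tmap_comp; try by move=> i; apply: iter_psi_linear.
by apply: tmap_ext => i f /=; rewrite iterD.
Qed.

Lemma tpsi_pow_ext al be U : al =1 be -> tpsi_pow al U = tpsi_pow be U.
Proof. by move=> E; apply: tmap_ext => i f; rewrite E. Qed.

Lemma tpsi_pow0 al U : (forall i, al i = 0%N) -> tpsi_pow al U = U.
Proof. by move=> E; apply: tmap_id => i f; rewrite E. Qed.

Lemma tpsiE i U : tpsi i U = tpsi_pow (fun j => (j == i) : nat) U.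
Proof. by apply: tmap_ext => j f; case: (j == i). Qed.

Lemma tpsi_pow_hom al d p U : thom d p U -> thom d p (tpsi_pow al U).
Proof. by apply: thom_tmap => i e q f; apply: iter_psi_hom. Qed.

Lemma tpsi_pow_mul al (U V : T) : tpsi_pow al (tmul U V) = tmul (tpsi_pow al U) (tpsi_pow al V).
Proof.
apply: tmap_mul => i; [exact: iter_psi_linear | exact: iter_psiM | ].
by move=> *; apply: iter_psi_hom.
Qed.

Lemma ttr_tpsi_pow al U : ttr (tpsi_pow al U) = ttr U.
Proof.
apply: ttr_tmap => [i|i f]; [exact: iter_psi_linear | exact: tr_iter_psi].
Qed.

(** The Nakayama relation of F in each position.  A nonzero trace forces the factors in
equal positions to have equal parity, which reduces the total sign to a sum of
parities. *)
Lemma ttr_nakayama d e p q (U V : T) : thom d p U -> thom e q V ->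
  ttr (tmul U V) = (-1) ^+ (p && q) * ttr (tmul V (tpsi_pow (fun _ => 1%N) U)).
Proof.
move=> hU hV.
apply: (thom_ind (Q := fun U => ttr (tmul U V) = _ * ttr (tmul V (tpsi_pow _ U))) hU)
  => [|x W W' h h'|a _ <-].
- rewrite (lin_0 (tmul_linl V)) (lin_0 (tpsi_pow_linear _)) (lin_0 (tmul_linr V)).
  by rewrite (scalar_0 ttr_scalar) mulr0.
- by rewrite (tmul_linl V) tpsi_pow_linear (tmul_linr V) !ttr_scalar h h' mulrDr mulrCA.
apply: (thom_ind (Q := fun V => ttr (tmul _ V) = _ * ttr (tmul V _)) hV) => [|x W W' h h'|c _ <-].
- by rewrite (lin_0 (tmul_linl _)) (lin_0 (tmul_linr _)) (scalar_0 ttr_scalar) mulr0.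
- by rewrite (tmul_linl _) (tmul_linr _) !ttr_scalar h h' mulrDr mulrCA.
have hpsi i : hom (dg (a i)) (pr (a i)) (psi (bb (a i))) by apply: psi_hom => //; apply: tbasis_hom.
rewrite /tbasis tpsi_pow_pure (tmul_pure (tbasis_hom a) (tbasis_hom c)).
rewrite (tmul_pure (tbasis_hom c) hpsi).
rewrite !(scalar_Z ttr_scalar) !ttr_pure /=.
have -> : \prod_i tr (bb (a i) * bb (c i)) =
   \prod_i ((-1) ^+ (pr (a i) && pr (c i)) * tr (bb (c i) * psi (bb (a i)))).
  by apply: eq_bigr => i _; rewrite (psi_tr hF (tbasis_hom a i) (tbasis_hom c i)).
rewrite big_split /=.
have [->|/eqP ne] := eqVneq (\prod_i tr (bb (c i) * psi (bb (a i)))) 0; first by rewrite !mulr0.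
have E i : pr (c i) = pr (a i).
  apply: (proj2 (tr_nz hF (tbasis_hom c i) (hpsi i) _)) => E; apply: ne.
  by rewrite (bigD1 i) //= E mul0r.
rewrite mulrA [RHS]mulrA; congr (_ * _); rewrite mulrC; congr (_ * _).
  under eq_bigr do rewrite E andbb; rewrite prodrXr.
  have -> : (\sum_i pr (c i) = \sum_i pr (a i))%N by apply: eq_bigr => i _; rewrite E.
  by rewrite andbb signr_odd.
by congr (_ ^+ _); apply: eq_bigr => i _; apply: eq_bigr => j _; rewrite !E.
Qed.

(** The scalar cancels the Koszul sign of the product with the basis tensor of [b] and the
signs in [tr_right_dual]. *)
Definition tdual b : T :=
  (msign (fun i => pr (b i)) (fun i => pr (b i)) * (-1) ^+ (\sum_i pr (b i)))
    *: pure (fun i => psi (bv (b i))).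

Lemma tdual_dual b c : ttr (tmul (tbasis c) (tdual b)) = (b == c)%:R.
Proof.
have hd i : exists d, hom d (pr (b i)) (psi (bv (b i))).
  by have [d h _] := dual_hom hF (b i); exists d; apply: psi_hom.
have [d hd'] := choice hd.
rewrite /tdual (lin_Z (tmul_linr _)) (tmul_pure (tbasis_hom c) hd').
rewrite !(scalar_Z ttr_scalar) ttr_pure /=.
have -> : \prod_i tr (bb (c i) * psi (bv (b i)))
    = \prod_i ((-1) ^+ pr (b i) * (b i == c i)%:R).
  by apply: eq_bigr => i _; apply: tr_right_dual.
have [<-|ne] := eqVneq b c.
  under [X in _ * (_ * X)]eq_bigr do rewrite eqxx mulr1.
  by rewrite prodrXr mulrACA /msign -!expr2 !sqrr_sign mulr1.
rewrite big_split /=; have -> : \prod_i (b i == c i)%:R = tbasis c b :> k.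
  by rewrite pureE; apply: eq_bigr => i _; rewrite (coef_fB hF).
by rewrite tbasisE eq_sym (negbTE ne) !mulr0.
Qed.

Definition pair_at (i j : 'I_N) (u v : F) : T :=
  pure (fun l => if l == i then u else if l == j then v else 1).

Definition par_at (i j : 'I_N) (p q : bool) (l : 'I_N) : bool :=
  if l == i then p else if l == j then q else false.

Lemma pair_at_hom (i j : 'I_N) (d e : nat) (p q : bool) (u v : F) l : hom d p u -> hom e q v ->
  hom (if l == i then d else if l == j then e else 0%N) (par_at i j p q l)
      (if l == i then u else if l == j then v else 1).
Proof.
by move=> hu hv; rewrite /par_at; case: (l == i) => //; case: (l == j) => //; apply: gsa_one.
Qed.

Lemma tat_hom (i : 'I_N) (d : nat) (p : bool) (u : F) : hom d p u -> thom d p (tat i u).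
Proof.
move=> hu; rewrite /tat.
have := @thom_pure (fun j => if j == i then d else 0%N) (fun j => (j == i) && p)
  (fun j => if j == i then u else 1).
rewrite (bigD1 i) //= eqxx big1 => [|j /negbTE -> //]; rewrite addn0.
rewrite (bigD1 i) //= eqxx big1 => [|j /negbTE -> //]; rewrite addn0 oddb.
by apply=> j; case: (j == i) => //; apply: gsa_one.
Qed.

Lemma tat_mul (i j : 'I_N) (d e : nat) (p q : bool) (u v : F) : i != j ->
  hom d p u -> hom e q v ->
  tmul (tat i u) (tat j v) = (-1) ^+ [&& (j < i)%N, p & q] *: pair_at i j u v.
Proof.
move=> nij hu hv.
have h1 l : hom (if l == i then d else 0%N) ((l == i) && p) (if l == i then u else 1).
  by case: (l == i) => //; apply: gsa_one.
have h2 l : hom (if l == j then e else 0%N) ((l == j) && q) (if l == j then v else 1).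
  by case: (l == j) => //; apply: gsa_one.
rewrite /tat (tmul_pure h1 h2); congr (_ *: _); last first.
  apply: pure_ext => l; case: eqVneq => [->|_]; first by rewrite (negbTE nij) mulr1.
  by rewrite mul1r.
rewrite /msign; congr (_ ^+ _).
rewrite (bigD1 i) //= [X in (_ + X)%N]big1 => [|l ne]; last first.
  by rewrite big1 // => l' _; rewrite (negbTE ne).
rewrite addn0 big_mkcond (bigD1 j) //= big1 => [|l ne]; last first.
  by rewrite (negbTE ne) andbF; case: ifP.
by rewrite !eqxx addn0 /=; case: (j < i)%N.
Qed.

Lemma ttE (i j : 'I_N) : i != j -> tt_ F i j =
  \sum_(b : fIdx F) (-1) ^+ ((j < i)%N && pr b) *: pair_at i j (bb b) (bv b).
Proof.
move=> nij; apply: eq_bigr => b _; have [d hd _] := dual_hom hF b.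
by rewrite (tat_mul nij (fB_hom hF b) hd) andbb.
Qed.

Lemma tt_hom (i j : 'I_N) : thom (fDelta F) false (tt_ F i j).
Proof.
apply: thom_sum => b _; have [d hd E] := dual_hom hF b.
rewrite -E addnC -(addbb (pr b)); apply: thom_mul; apply: tat_hom => //.
exact: fB_hom.
Qed.

Lemma pair_atC (i j : 'I_N) (u v : F) : i != j -> pair_at i j u v = pair_at j i v u.
Proof.
move=> nij; apply: pure_ext => l; case: eqVneq => // ->.
by rewrite (negbTE nij).
Qed.

Lemma tpsi_pair_at (i j : 'I_N) (u v : F) : i != j ->
  tpsi j (pair_at i j u v) = pair_at i j u (psi v).
Proof.
move=> nij; rewrite tpsiE tpsi_pow_pure; apply: pure_ext => l.
case: (eqVneq l j) => [->|nl] /=; first by rewrite eq_sym (negbTE nij).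
by [].
Qed.

(** This twisted symmetry of the canonical element is what makes x_i x_(i+1) commute with
s_i.  Evaluated at the basis tensor b, each side reduces to one summand, and the two are
compared by [coef_psi_dual]. *)
Lemma tpsi_tt (i j : 'I_N) : i != j -> tpsi j (tt_ F i j) = tt_ F j i.
Proof.
move=> nij; have nji : j != i by rewrite eq_sym.
rewrite (ttE nij) (ttE nji) (lin_sum (tpsi_linear _)).
have pairE (u v : F) b : pair_at i j u v b = coef (b i) u * coef (b j) v *
    \prod_(l | (l != i) && (l != j)) coef (b l) 1 :> k.
  rewrite pureE (bigD1 i) //= (bigD1 j) //= !eqxx (negbTE nji) mulrA; congr (_ * _).
  by apply: eq_bigr => l /andP[/negbTE -> /negbTE ->].
apply/ffunP => b; rewrite !sum_ffunE.
have tpE a : tpsi j ((-1) ^+ ((j < i)%N && pr a) *: pair_at i j (bb a) (bv a)) b =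
    (-1) ^+ ((j < i)%N && pr a) *: (coef (b i) (bb a) * coef (b j) (psi (bv a)) *
    \prod_(l | (l != i) && (l != j)) coef (b l) 1 : k^o).
  by rewrite (lin_Z (tpsi_linear _)) (tpsi_pair_at _ _ nij) ffunE pairE.
have ppE a : ((-1) ^+ ((i < j)%N && pr a) *: pair_at j i (bb a) (bv a)) b =
    (-1) ^+ ((i < j)%N && pr a) *: (coef (b i) (bv a) * coef (b j) (bb a) *
    \prod_(l | (l != i) && (l != j)) coef (b l) 1 : k^o).
  by rewrite ffunE (pair_atC _ _ nji) pairE.
rewrite (bigD1 (b i)) //= tpE [X in _ + X = _]big1 ?addr0 => [|a ne]; last first.
  by rewrite tpE (coef_fB hF) eq_sym (negbTE ne) !mul0r scaler0.
rewrite [RHS](bigD1 (b j)) //= ppE [X in _ = _ + X]big1 ?addr0 => [|a ne]; last first.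
  by rewrite ppE (coef_fB hF) eq_sym (negbTE ne) mulr0 mul0r scaler0.
rewrite !(coef_fB hF) !eqxx mul1r mulr1 (coef_psi_dual hF).
rewrite -[LHS]/(_ * _) -[RHS]/(_ * _) !mulrA; congr (_ * _).
have [->|/eqP ne] := eqVneq (coef (b i) (bv (b j))) 0; first by rewrite !mulr0.
have [d hd _] := dual_hom hF (b i); have [e he _] := dual_hom hF (b j).
have [_ ->] := tr_nz hF hd he ne.
congr (_ * _); rewrite -signr_addb; congr (_ ^+ _).
by case: (ltngtP i j) nij => [||/val_inj ->]; rewrite ?eqxx //; case: (pr _).
Qed.

(** Exchanging the factors b and b^v costs the sign that the opposite order of the
product in [tt_] contributes. *)
Lemma tact_tt (i j : 'I_N) : (i < j)%N -> tact (tperm i j) (tt_ F i j) = tt_ F j i.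
Proof.
move=> lij; have nij : i != j by apply: contraTneq lij => ->; rewrite ltnn.
have nji : j != i by rewrite eq_sym.
rewrite (ttE nij) (ttE nji) (lin_sum (tact_linear _)); apply: eq_bigr => b _.
have [d hd _] := dual_hom hF b.
rewrite (lin_Z (tact_linear _)) (tact_pure _ (fun l => pair_at_hom i j l (fB_hom hF b) hd)).
rewrite scalerA lij ltnNge (ltnW lij) /= mul1r; congr (_ *: _); last first.
  apply: pure_ext => l; rewrite tpermV; case: tpermP => [->|->|/eqP ni /eqP nj].
  - by rewrite !eqxx (negbTE nij) (negbTE nji).
  - by rewrite !eqxx.
  - by rewrite (negbTE ni) (negbTE nj).
rewrite /psign; congr (_ ^+ _).
have p0 l : l != i -> l != j -> par_at i j (pr b) (pr b) l = false.
  by rewrite /par_at => /negbTE -> /negbTE ->.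
rewrite (bigD1 i) //= (bigD1 j) /=; last by rewrite lij !apermE tpermL tpermR.
rewrite big1 => [|l /andP[/andP[lil _] nj]]; last first.
  by rewrite (p0 l) ?andbF //; apply: contraTneq lil => ->; rewrite ltnn.
rewrite big1 => [|l ni]; last first.
  have [->|nj] := eqVneq l j; last by rewrite big1 // => m _; rewrite (p0 l).
  rewrite big1 // => m /andP[ljm _]; rewrite (p0 m) ?andbF //.
    by apply: contraTneq ljm => ->; rewrite -leqNgt ltnW.
  by apply: contraTneq ljm => ->; rewrite ltnn.
by rewrite /par_at !eqxx (negbTE nji) andbb !addn0.
Qed.

(** Apply [tpsi_tt] to the two positions in turn; psi fixes the unit in all others. *)
Lemma tpsi_pow1_tt (i j : 'I_N) : i != j -> tpsi_pow (fun _ => 1%N) (tt_ F i j) = tt_ F i j.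
Proof.
move=> nij; have nji : j != i by rewrite eq_sym.
rewrite -[RHS](tpsi_tt nji) -[X in tpsi i X](tpsi_tt nij) !tpsiE tpsi_powD (ttE nij).
rewrite !(lin_sum (tpsi_pow_linear _)); apply: eq_bigr => b _.
rewrite !(lin_Z (tpsi_pow_linear _)) !tpsi_pow_pure; congr (_ *: _).
apply: pure_ext => l; case: (eqVneq l i) => [->|ni]; first by rewrite (negbTE nij).
by case: (eqVneq l j) => //= _; rewrite psi1.
Qed.

Lemma tpsi_powc_tt m (i j : 'I_N) : i != j -> tpsi_pow (fun _ => m) (tt_ F i j) = tt_ F i j.
Proof.
move=> nij; elim: m => [|m IH]; first by rewrite tpsi_pow0.
rewrite -[RHS]IH -{2}(tpsi_pow1_tt nij) tpsi_powD; apply: tpsi_pow_ext => l.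
by rewrite addn1.
Qed.

End Tensor.

Arguments thom_tbasis {k F N} hF b.
Arguments tt_hom {k F N} hF i j.
Arguments thom_one {k F} N hF.

(** * Spans and exponent vectors *)

Section Lspan.
Variables (k : comNzRingType) (V W : lmodType k).

Lemma lspanD (P : V -> Prop) u v : lspan P u -> lspan P v -> lspan P (u + v).
Proof. by move=> hu hv; rewrite -[u]scale1r; apply: lspan_lin. Qed.
Lemma lspanZ (P : V -> Prop) a u : lspan P u -> lspan P (a *: u).
Proof. by move=> hu; rewrite -[_ *: _]addr0; apply: lspan_lin => //; apply: lspan0. Qed.
Lemma lspanN (P : V -> Prop) u : lspan P u -> lspan P (- u).
Proof. by move=> hu; rewrite -scaleN1r; apply: lspanZ. Qed.
Lemma lspanB (P : V -> Prop) u v : lspan P u -> lspan P v -> lspan P (u - v).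
Proof. by move=> hu hv; apply/lspanD/lspanN. Qed.
Lemma lspan_sum (P : V -> Prop) I (r : seq I) (Q : pred I) (E : I -> V) :
  (forall i, Q i -> lspan P (E i)) -> lspan P (\sum_(i <- r | Q i) E i).
Proof. by move=> H; elim/big_ind: _ => //; [apply: lspan0 | apply: lspanD]. Qed.
Lemma lspan_map (P : V -> Prop) (Q : W -> Prop) (G : V -> W) u : linear G ->
  (forall v, P v -> lspan Q (G v)) -> lspan P u -> lspan Q (G u).
Proof.
move=> lG H; elim=> {u} [v /H //||a u v _ hu _ hv].
  by rewrite (lin_0 lG); apply: lspan0.
by rewrite lG; apply: lspan_lin.
Qed.
End Lspan.

Lemma lspan_trans (k : comNzRingType) (V : lmodType k) (P Q : V -> Prop) u :
  (forall v, P v -> lspan Q v) -> lspan P u -> lspan Q u.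
Proof. by move=> H; apply: (lspan_map (G := id)). Qed.

Lemma mull_linear (k : comNzRingType) (A : pzAlg k) (x : A) : linear (fun u : A => x * u).
Proof. by move=> a u v; rewrite mulrDr algZr. Qed.
Lemma mulr_linear (k : comNzRingType) (A : pzAlg k) (x : A) : linear (fun u : A => u * x).
Proof. by move=> a u v; rewrite mulrDl algZl. Qed.

Section Weights.
Variable N : nat.
Implicit Types al be : 'I_N -> nat.
Definition wt al : nat := \sum_i al i.
Definition unit_wt (i : 'I_N) : 'I_N -> nat := fun j => (j == i) : nat.
Definition addw al be : 'I_N -> nat := fun j => (al j + be j)%N.

Lemma wt_unit i : wt (unit_wt i) = 1%N.
Proof. by rewrite /wt (bigD1 i) //= /unit_wt eqxx big1 // => j /negbTE ->. Qed.
Lemma wt_add al be : wt (addw al be) = (wt al + wt be)%N.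
Proof. exact: big_split. Qed.
Lemma wt_perm al (s : 'S_N) : wt (fun i => al (s i)) = wt al.
Proof. by rewrite /wt [RHS](reindex_inj (@perm_inj _ s)). Qed.
Lemma wt0 : wt (fun _ => 0%N) = 0%N.
Proof. by rewrite /wt big1. Qed.
Lemma wt_eq0 al : wt al = 0%N -> al = fun _ => 0%N.
Proof.
move=> /eqP; rewrite /wt sum_nat_eq0 => /forallP H; apply: funext => i.
by apply/eqP; exact: H.
Qed.

(** Monomials are built by multiplying by one variable on the left at a time. *)
Lemma wt_ind (Q : ('I_N -> nat) -> Prop) : Q (fun _ => 0%N) ->
  (forall i be, Q be -> Q (addw (unit_wt i) be)) -> forall al, Q al.
Proof.
move=> Q0 QS al; move E : (wt al) => w; elim: w al E => [|w IH] al E.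
  by rewrite (wt_eq0 E).
have [i ip] : exists i, (0 < al i)%N.
  apply/existsP; apply: contraT; rewrite negb_exists => /forallP H; move: E.
  by rewrite /wt big1 // => i _; apply/eqP; move: (H i); rewrite -eqn0Ngt.
pose be j := (al j - (j == i))%N.
have Ea : al = addw (unit_wt i) be.
  apply: funext => j; rewrite /addw /unit_wt /be.
  by case: eqVneq => [->|_]; rewrite ?subn0 // addnBA // add1n subn1.
rewrite Ea; apply: QS; apply: IH; apply: succn_inj.
by rewrite -E Ea wt_add wt_unit.
Qed.
End Weights.

(** * Filtration by total degree *)

Section Wreath.
Variables (k : comNzRingType) (F : frobData k) (n : nat) (R : pzAlg k).
Hypothesis hF : is_frobData F.
Notation N := n.+1.
Notation T := (tpow F N).
Notation idx := (tidx F N).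
Notation delta := (fDelta F).
Notation dg := (fDeg F).
Notation pr := (fPar F).
Variables (X : 'I_N -> R) (Ft : T -> R) (S : 'S_N -> R).

(** The defining relations, for elements of an arbitrary algebra R.  Working with R
instead of the iterated quotient keeps the quotient construction out of the
computations. *)
Record wreath_rels : Prop := {
  wXX : forall i j, X i * X j = X j * X i;
  wFlin : linear Ft;
  wF1 : Ft (tone F N) = 1;
  wFM : forall f g, Ft (tmul f g) = Ft f * Ft g;
  wS1 : S 1%g = 1;
  wSM : forall s s' : 'S_N, S (s' * s)%g = S s * S s';
  wFX : forall f i, Ft f * X i = X i * Ft (tpsi i f);
  wSX0 : forall i i' j : 'I_N, i' = i.+1 :> nat -> j != i -> j != i' ->
    S (tperm i i') * X j = X j * S (tperm i i');
  wSX : forall i i' : 'I_N, i' = i.+1 :> nat ->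
    S (tperm i i') * X i = X i' * S (tperm i i') - Ft (tt_ F i i');
  wSF : forall s f, S s * Ft f = Ft (tact s f) * S s
}.
Hypothesis hR : wreath_rels.

Definition mon (al : 'I_N -> nat) : R := \prod_i X i ^+ al i.

Lemma mon0 : mon (fun _ => 0%N) = 1.
Proof. by rewrite /mon big1. Qed.

Lemma mon_add al be : mon (addw al be) = mon al * mon be.
Proof.
rewrite /mon -GRing.prodrM_comm => [|i j _ _].
  by apply: eq_bigr => i _; rewrite exprD.
by apply/commrX/commr_sym/commrX; apply: (wXX hR).
Qed.

Lemma mon_Xn i m : mon (fun j => if j == i then m else 0%N) = X i ^+ m.
Proof.
have -> : mon (fun j => if j == i then m else 0%N) = \prod_(j | j == i) X j ^+ m.
  by rewrite [RHS]big_mkcond; apply: eq_bigr => j _; case: (j == i).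
by rewrite big_pred1_eq.
Qed.

Lemma mon_unit i : mon (unit_wt i) = X i.
Proof.
by rewrite -[RHS]expr1 -mon_Xn.
Qed.

Lemma wt_Xn (i : 'I_N) m : wt (fun j => if j == i then m else 0%N) = m.
Proof. by rewrite /wt (bigD1 i) //= eqxx big1 ?addn0 // => j /negbTE ->. Qed.

Lemma Ft_mon f al : Ft f * mon al = mon al * Ft (tpsi_pow al f).
Proof.
elim/wt_ind: al f => [|i al IH] f.
  by rewrite mon0 mulr1 mul1r tpsi_pow0.
rewrite mon_add mon_unit mulrA (wFX hR) -mulrA IH mulrA; congr (_ * Ft _).
rewrite tpsiE tpsi_powD //; apply: tpsi_pow_ext => j; rewrite /addw /unit_wt addnC.
by [].
Qed.

Definition bas al (b : idx) (s : 'S_N) : R := mon al * Ft (tbasis b) * S s.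
Definition dgb (b : idx) : nat := \sum_i dg (b i).
Definition prb (b : idx) : bool := odd (\sum_i pr (b i)).

(** Elements of degree D and parity p that involve monomials of total degree < m only.
The strict bound makes [filt 0] zero, which is the right notion of lower terms also for a
relation of degree 0. *)
Definition filt (m D : nat) (p : bool) : R -> Prop := lspan (fun u =>
  exists al b s, [/\ (wt al < m)%N, (wt al * delta + dgb b)%N = D, prb b = p & u = bas al b s]).

Lemma filt_mono m m' D p u : (m <= m')%N -> filt m D p u -> filt m' D p u.
Proof.
move=> le; apply: lspan_trans => v [al [b [s [h1 h2 h3 ->]]]].
by apply: lspan_base; exists al, b, s; split=> //; apply: leq_trans le.
Qed.

Lemma filt_F al f s m D p : (wt al < m)%N -> thom D p f ->
  filt m (wt al * delta + D) p (mon al * Ft f * S s).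
Proof.
move=> lt hf.
apply: (thom_ind hF (Q := fun f => filt m _ p (mon al * Ft f * S s)) hf) => [|x U V hU hV|b <- <-].
- by rewrite (lin_0 (wFlin hR)) mulr0 mul0r; apply: lspan0.
- by rewrite (wFlin hR) mulrDr algZr mulrDl algZl; apply: lspan_lin.
- by apply: lspan_base; exists al, b, s.
Qed.

Lemma filt_F1 f s D p : thom D p f -> filt 1 D p (Ft f * S s).
Proof.
move=> hf; have := @filt_F (fun _ => 0%N) f s 1 D p.
by rewrite wt0 mul0n mon0 mul1r; apply.
Qed.

Lemma filt_monl al m D p u : filt m D p u -> filt (wt al + m) (wt al * delta + D) p (mon al * u).
Proof.
apply: (lspan_map (mull_linear (mon al))) => _ [be [b [s [h1 <- <- ->]]]].
apply: lspan_base; exists (addw al be), b, s; split=> //.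
- by rewrite wt_add ltn_add2l.
- by rewrite wt_add mulnDl addnA.
- by rewrite /bas mon_add !mulrA.
Qed.

Lemma filt_Xl i m D p u : filt m D p u -> filt m.+1 (delta + D) p (X i * u).
Proof.
by move=> /(filt_monl (unit_wt i)); rewrite wt_unit mul1n mon_unit add1n.
Qed.

Lemma filt_Fl f m D p D' p' u : thom D' p' f -> filt m D p u ->
  filt m (D' + D) (p' (+) p) (Ft f * u).
Proof.
move=> hf; apply: (lspan_map (mull_linear _)) => _ [al [b [s [h1 <- <- ->]]]].
rewrite /bas !mulrA Ft_mon -[_ * Ft (tbasis b)]mulrA -(wFM hR) addnCA.
apply: filt_F => //; apply: thom_mul => //; last exact: thom_tbasis.
exact: tpsi_pow_hom.
Qed.

Lemma filt_Sr s m D p u : filt m D p u -> filt m D p (u * S s).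
Proof.
apply: (lspan_map (mulr_linear _)) => _ [al [b [s' [h1 <- <- ->]]]].
rewrite /bas -mulrA -(wSM hR); apply: filt_F => //; exact: thom_tbasis.
Qed.

Lemma filt_Fr f m D p D' p' u : thom D' p' f -> filt m D p u ->
  filt m (D + D') (p (+) p') (u * Ft f).
Proof.
move=> hf; apply: (lspan_map (mulr_linear _)) => _ [al [b [s [h1 <- <- ->]]]].
rewrite /bas -[_ * S s * _]mulrA (wSF hR) mulrA -[_ * Ft (tbasis b) * _]mulrA -(wFM hR) -addnA.
by apply: filt_F => //; apply: thom_mul => //; [exact: thom_tbasis | exact: thom_tact].
Qed.

Lemma filt_Sl1 s D p u : filt 1 D p u -> filt 1 D p (S s * u).
Proof.
apply: (lspan_map (mull_linear _)) => _ [al [b [s' [h1 <- <- ->]]]].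
have E : wt al = 0%N by case: (wt al) h1.
rewrite E mul0n /bas (wt_eq0 E) mon0 mul1r mulrA (wSF hR) -mulrA -(wSM hR).
by apply: filt_F1; apply: thom_tact; exact: thom_tbasis.
Qed.

(** The relations only concern adjacent transpositions.  They generate S_N since (1 m+2)
is the conjugate of (1 m+1) by (m+1 m+2). *)
Lemma adjacent_gen (Q : 'S_N -> Prop) : Q 1%g ->
  (forall s s', Q s -> Q s' -> Q (s * s')%g) ->
  (forall i i' : 'I_N, i' = i.+1 :> nat -> Q (tperm i i')) -> forall s, Q s.
Proof.
move=> Q1 QM Qa s.
have gQ : group_set [set s : 'S_N | `[< Q s >]].
  apply/group_setP; split; first by rewrite inE; apply/asboolP.
  by move=> x y; rewrite !inE => /asboolP ? /asboolP ?; apply/asboolP/QM.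
pose G := Group gQ.
have : s \in G; last by rewrite inE => /asboolP.
suff : [set: 'S_N] \subset G by move/subsetP; apply; rewrite inE.
rewrite -(gen_tperm (ord0 : 'I_N)) gen_subG; apply/subsetP => _ /imsetP[j _ ->].
case: j => m ltm; elim: m ltm => [|m IH] ltm.
  have -> : Ordinal ltm = ord0 by apply: val_inj.
  by rewrite tperm1 group1.
have ltm' : (m < N)%N := ltnW ltm.
have adj : tperm (Ordinal ltm') (Ordinal ltm) \in G.
  by rewrite inE; apply/asboolP/Qa.
case: m IH ltm ltm' adj => [|m] IH ltm ltm' adj.
  by rewrite (_ : ord0 = Ordinal ltm') //; apply: val_inj.
have := groupJ (IH ltm') adj.
rewrite tpermJ tpermL tpermD //.
Qed.

Lemma S_tperm2 i j : S (tperm i j) * S (tperm i j) = 1.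
Proof. by rewrite -(wSM hR) tperm2 (wS1 hR). Qed.

Lemma X_succ (i i' : 'I_N) : i' = i.+1 :> nat ->
  X i' = (S (tperm i i') * X i + Ft (tt_ F i i')) * S (tperm i i').
Proof. by move=> ii'; rewrite (wSX hR) // subrK -mulrA S_tperm2 mulr1. Qed.

(** The relation for s_i x_i, conjugated by s_i; the action of s_i turns t_(i,i+1) into
t_(i+1,i). *)
Lemma S_Xsucc (i i' : 'I_N) : i' = i.+1 :> nat ->
  S (tperm i i') * X i' = X i * S (tperm i i') + Ft (tt_ F i' i).
Proof.
move=> ii'; have lt : (i < i')%N by rewrite ii'.
rewrite (X_succ ii') !mulrA mulrDr mulrA S_tperm2 mul1r (wSF hR) tact_tt // mulrDl.
by rewrite -[_ * _ * S _]mulrA S_tperm2 mulr1.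
Qed.

(** In the associated graded algebra S_N permutes the variables.  The error lies in the
span of the f sigma, which is stable under S_N on both sides, so the statement is
multiplicative in s. *)
Lemma S_X s i : exists2 z, filt 1 delta false z & S s * X i = X (s i) * S s + z.
Proof.
elim/adjacent_gen: s i => [|s s' Qs Qs'|i i' ii'] j.
- by exists 0; [apply: lspan0 | rewrite perm1 (wS1 hR) mul1r mulr1 addr0].
- have [z hz E] := Qs j; have [z' hz' E'] := Qs' (s j).
  exists (z' * S s + S s' * z).
    by apply: lspanD; [apply: filt_Sr | apply: filt_Sl1].
  by rewrite (wSM hR) -mulrA E mulrDr mulrA E' permM mulrDl -!mulrA addrA.
have lt : (i < i')%N by rewrite ii'.
have ht := tt_hom hF i i'.
have [->|ni] := eqVneq j i.
  exists (- Ft (tt_ F i i')); last by rewrite tpermL (wSX hR).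
  apply: lspanN; have := filt_F1 1%g ht; by rewrite (wS1 hR) mulr1.
have [->|ni'] := eqVneq j i'; last first.
  by exists 0; [apply: lspan0 | rewrite (wSX0 hR) // tpermD 1?eq_sym // addr0].
exists (Ft (tt_ F i' i)); last by rewrite tpermR S_Xsucc.
by have := filt_F1 1%g (tt_hom hF i' i); rewrite (wS1 hR) mulr1.
Qed.

Lemma S_mon s al : exists2 z, filt (wt al) (wt al * delta) false z &
  S s * mon al = mon (fun i => al ((s^-1)%g i)) * S s + z.
Proof.
elim/wt_ind: al s => [|i al IH] s.
  by exists 0; [apply: lspan0 | rewrite !mon0 mul1r mulr1 addr0].
have [z hz E] := S_X s i; have [z1 hz1 E1] := IH s.
exists (X (s i) * z1 + z * mon al); last first.
  rewrite mon_add mon_unit mulrA E mulrDl -mulrA E1 mulrDr addrA; congr (_ + _ + _).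
  rewrite mulrA -{1}mon_unit -mon_add; congr (mon _ * _); apply: funext => j.
  rewrite /addw /unit_wt; congr (_ + _)%N.
  by rewrite -[in RHS](inj_eq (@perm_inj _ s)) permKV.
rewrite wt_add wt_unit mulnDl mul1n add1n; apply: lspanD; first exact: filt_Xl.
move: hz; apply: (lspan_map (mulr_linear _)) => _ [be [b [s' [h1 hD hp ->]]]].
have Eb : wt be = 0%N by case: (wt be) h1.
move: hD; rewrite Eb mul0n add0n => hD; rewrite /bas (wt_eq0 Eb) mon0 mul1r -mulrA.
have [z2 hz2 ->] := IH s'; rewrite mulrDr mulrA Ft_mon.
have hb := thom_tbasis hF b; rewrite -/(dgb b) -/(prb b) hD hp in hb; apply: lspanD.
  rewrite addnC -(wt_perm al s'^-1); apply: filt_F; last exact: tpsi_pow_hom.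
  by rewrite wt_perm.
by apply: filt_mono (filt_Fl hb hz2); exact: leqnSn.
Qed.

Lemma filt_Sl s m D p u : filt m D p u -> filt m D p (S s * u).
Proof.
apply: (lspan_map (mull_linear _)) => _ [al [b [s' [h1 <- <- ->]]]].
have [z hz E] := S_mon s al; have hb := thom_tbasis hF b.
rewrite /bas !mulrA E !mulrDl; apply: lspanD; last first.
  apply: filt_mono (ltnW h1) _; rewrite -[prb b]addFb.
  by apply: filt_Sr; apply: filt_Fr.
rewrite -[_ * S s * _]mulrA (wSF hR) mulrA -[_ * S s * _]mulrA -(wSM hR).
by rewrite -(wt_perm al s^-1); apply: filt_F; [rewrite wt_perm | exact: thom_tact].
Qed.

Lemma filt_Xr i m D p u : filt m D p u -> filt m.+1 (D + delta) p (u * X i).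
Proof.
apply: (lspan_map (mulr_linear _)) => _ [al [b [s [h1 <- <- ->]]]].
have [z hz E] := S_X s i; have hb := thom_tbasis hF b.
rewrite /bas -[_ * S s * _]mulrA E mulrDr; apply: lspanD.
  rewrite !mulrA -[_ * Ft _ * _]mulrA (wFX hR) mulrA -{1}mon_unit -mon_add.
  rewrite (_ : _ + _ = wt (addw al (unit_wt i)) * delta + dgb b)%N; last first.
    by rewrite wt_add wt_unit mulnDl mul1n addnAC.
  rewrite tpsiE.
  have -> : wt (addw al (unit_wt i)) = wt (addw al (unit_wt (s i))).
    by rewrite !wt_add !wt_unit.
  apply: filt_F; last exact: tpsi_pow_hom.
  by rewrite wt_add wt_unit addn1.
rewrite -mulrA -addnA -[prb b]addbF.
apply: (@filt_mono (wt al + 1)); first by rewrite addn1 leqW.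
exact: filt_monl (filt_Fl hb hz).
Qed.

Lemma filt_monr al m D p u : filt m D p u -> filt (m + wt al) (D + wt al * delta) p (u * mon al).
Proof.
elim/wt_ind: al m D p u => [|i al IH] m D p u hu.
  by rewrite wt0 !addn0 mon0 mulr1.
rewrite wt_add wt_unit mon_add mon_unit mulrA mulnDl mul1n !addnA addn1.
by apply: IH; apply: filt_Xr.
Qed.

Lemma filt_mul m m' D D' p p' u v : filt m D p u -> filt m'.+1 D' p' v ->
  filt (m + m') (D + D') (p (+) p') (u * v).
Proof.
move=> hu; apply: (lspan_map (mull_linear _)) => _ [al [b [s [h1 <- <- ->]]]].
rewrite /bas !mulrA; apply: filt_Sr; rewrite addnA.
apply: filt_Fr; first exact: thom_tbasis.
by apply: filt_mono (filt_monr al hu); rewrite leq_add2l.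
Qed.

Inductive wGen : nat -> bool -> R -> Prop :=
| wGen_X i : wGen delta false (X i)
| wGen_F d p f : thom d p f -> wGen d p (Ft f)
| wGen_S s : wGen 0 false (S s).

(** Every homogeneous element is a combination of monomials of its own degree and parity;
this is how the grading of the quotient is controlled. *)
Lemma homGen_filt D p u : homGen wGen D p u -> exists m, filt m D p u.
Proof.
elim=> {D p u} [D p u|||D p c u v _ [m hu] _ [m' hv]|D E p q u v _ [m hu] _ [m' hv]].
- case=> [i|d q f hf|s].
  + exists 2; have := @filt_F (unit_wt i) (tone F N) 1%g 2 0 false.
    rewrite wt_unit mul1n addn0 mon_unit (wF1 hR) (wS1 hR) !mulr1.
    by apply=> //; exact: thom_one.
  + by exists 1; have := filt_F1 1%g hf; rewrite (wS1 hR) mulr1.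
  + exists 1; have := filt_F1 s (thom_one N hF); by rewrite (wF1 hR) mul1r.
- exists 1; have := filt_F1 1%g (thom_one N hF); by rewrite (wF1 hR) (wS1 hR) mul1r.
- by move=> D p; exists 0; apply: lspan0.
- exists (maxn m m'); apply: lspan_lin.
    by apply: filt_mono hu; exact: leq_maxl.
  by apply: filt_mono hv; exact: leq_maxr.
- exists (m + m')%N; apply: filt_mul => //; exact: filt_mono hv.
Qed.

Lemma homGen_mon al : homGen wGen (wt al * delta) false (mon al).
Proof.
elim/wt_ind: al => [|i al IH]; first by rewrite wt0 mon0; apply: hom_one.
rewrite wt_add wt_unit mon_add mon_unit mulnDl mul1n -[false]/(false (+) false).
by apply: hom_mul => //; apply/hom_base/wGen_X.
Qed.

Lemma homGen_bas al b s : homGen wGen (wt al * delta + dgb b) (prb b) (bas al b s).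
Proof.
rewrite -[(_ + _)%N]addn0 -[prb b]addbF; apply: hom_mul; last exact/hom_base/wGen_S.
rewrite -[prb b]addFb; apply: hom_mul; first exact: homGen_mon.
by apply/hom_base/wGen_F; exact: thom_tbasis.
Qed.

Section Reduction.
Variables (d : nat) (c : nat -> T).
Hypothesis chom : forall m, (m < d)%N -> thom ((d - m) * delta) false (c m).
Hypothesis Xd : X ord0 ^+ d = \sum_(m < d) X ord0 ^+ m * Ft (c m).

Lemma filt_Xd0 : filt d (d * delta) false (X ord0 ^+ d).
Proof.
rewrite Xd; apply: lspan_sum => m _.
have := @filt_F _ (c m) 1%g d _ _
  (_ : (wt (fun j : 'I_N => if j == ord0 then m : nat else 0%N) < d)%N) (chom (ltn_ord m)).
rewrite mon_Xn wt_Xn (wS1 hR) mulr1 -mulnDl subnKC ?(ltnW (ltn_ord m)) //.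
by apply.
Qed.

(** Conjugate the relation for x_1 by the transposition (1 i). *)
Lemma filt_Xd i : filt d (d * delta) false (X i ^+ d).
Proof.
pose s := tperm ord0 i.
have [z hz] := S_mon s (fun j => if j == ord0 then d else 0%N).
rewrite mon_Xn wt_Xn in hz * => E.
have E' : (fun j : 'I_N => if (s^-1)%g j == ord0 then d else 0%N) =
    (fun j => if j == i then d else 0%N).
  apply: funext => j; rewrite /s tpermV; congr (if _ then _ else _).
  by rewrite -(inj_eq (@perm_inj _ (tperm ord0 i))) tpermK tpermL.
rewrite E' mon_Xn in E.
(* solve the commutation rule for x_i^d *)
have -> : X i ^+ d = (S s * X ord0 ^+ d - z) * S (s^-1)%g.
  by rewrite E addrK -mulrA -(wSM hR) mulVg (wS1 hR) mulr1.
by apply: filt_Sr; apply: lspanB => //; apply: filt_Sl; exact: filt_Xd0.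
Qed.

Lemma filt_high al f s D p i : (d <= al i)%N -> thom D p f ->
  filt (wt al) (wt al * delta + D) p (mon al * Ft f * S s).
Proof.
move=> le hf; apply: filt_Sr; rewrite -[p]addFb; apply: filt_Fr => //.
pose be j := (al j - (if j == i then d else 0))%N.
have -> : al = addw be (fun j => if j == i then d else 0%N).
  by apply: funext => j; rewrite /addw /be subnK //; case: eqVneq => // ->.
rewrite mon_add mon_Xn wt_add wt_Xn mulnDl.
by apply: filt_monl; exact: filt_Xd.
Qed.

Definition filt_reduced (m D : nat) (p : bool) : R -> Prop := lspan (fun u =>
  exists al b s, [/\ (forall i, al i < d)%N, (wt al < m)%N,
    (wt al * delta + dgb b)%N = D, prb b = p & u = bas al b s]).

(** A monomial with some a_i >= d contains x_i^d, hence lies in strictly smaller total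
degree; induct on the total degree. *)
Lemma filt_reduce m D p u : filt m D p u -> filt_reduced m D p u.
Proof.
elim: m D p u => [|m IH] D p u; apply: lspan_trans => v [al [b [s [h1 h2 h3 ->]]]] //.
have [h4|] := boolP [forall i, (al i < d)%N].
  by apply: lspan_base; exists al, b, s; split=> //; apply/forallP.
rewrite negb_forall => /existsP[i]; rewrite -leqNgt => le.
have hu := filt_high s le (thom_tbasis hF b).
have := IH _ _ _ (filt_mono (_ : wt al <= m)%N hu).
rewrite -/(dgb b) h2 -/(prb b) h3 => /(_ h1).
by apply: lspan_trans => _ [al' [b' [s' [? ? ? ? ->]]]]; apply: lspan_base;
  exists al', b', s'; split=> //; apply: ltnW.
Qed.
End Reduction.
End Wreath.

(** * The trace form on monomials *)

Section Trace.
Variables (k : comNzRingType) (F : frobData k) (n : nat) (R : pzAlg k).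
Hypothesis hF : is_frobData F.
Notation N := n.+1.
Notation T := (tpow F N).
Notation idx := (tidx F N).
Notation delta := (fDelta F).
Notation dg := (fDeg F).
Notation pr := (fPar F).
Variables (X : 'I_N -> R) (Ft : T -> R) (S : 'S_N -> R).
Hypothesis hR : wreath_rels X Ft S.
Variables (d' : nat) (c : nat -> T).
Notation d := d'.+1.
Hypothesis chom : forall m, (m < d)%N -> thom ((d - m) * delta) false (c m).
Hypothesis cpsi : forall m i, (m < d)%N -> tpsi i (c m) = c m.
Hypothesis Xd : X ord0 ^+ d = \sum_(m < d) X ord0 ^+ m * Ft (c m).
Variable tr : R -> k.
Hypothesis tr_lin : scalar tr.
Hypothesis trE : forall al f s, (forall i, al i < d)%N ->
  tr (mon X al * Ft f * S s) = [forall i, al i == d']%:R * ttr f * (s == 1%g)%:R.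

Notation xmon := (mon X).
Notation xbas := (bas X Ft S).
Notation xfilt := (filt X Ft S).

Implicit Types al : 'I_N -> nat.
(** The total degree of x^(d-1, ..., d-1), where d = d' + 1. *)
Definition top : nat := (N * d')%N.
Definition cwt (m : nat) : 'I_N -> nat := fun _ => m.

Lemma wt_const m : wt (cwt m) = (N * m)%N.
Proof. by rewrite /wt sum_nat_const card_ord. Qed.

Lemma forall_cwt (al : 'I_N -> nat) m : [forall i, al i == m] -> al = cwt m.
Proof. by move=> /forallP H; apply: funext => i; apply/eqP. Qed.

Lemma Ft_sum f : Ft f = \sum_b (f b : k) *: Ft (tbasis b).
Proof.
rewrite {1}(tpow_expand hF f) (lin_sum (wFlin hR)).
by apply: eq_bigr => b _; rewrite (lin_Z (wFlin hR)).
Qed.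

Lemma tr_filt D p u : xfilt top D p u -> tr u = 0.
Proof.
move=> /(filt_reduce hF hR chom Xd).
elim=> {u} [_ [al [b [s [h1 h2 _ _ ->]]]]||a u v _ hu _ hv].
- rewrite trE //; case: (boolP [forall i, _]) => [/forall_cwt E|_]; last by rewrite !mul0r.
  by move: h2; rewrite E wt_const ltnn.
- exact: scalar_0.
- by rewrite tr_lin hu hv mulr0 addr0.
Qed.

(** The prescribed formula persists for monomials that are not reduced, as long as the
total degree is at most [top]: if some a_i >= d, then both sides vanish. *)
Lemma tr_top al f s : (wt al <= top)%N ->
  tr (xmon al * Ft f * S s) = [forall i, al i == d']%:R * ttr f * (s == 1%g)%:R.
Proof.
move=> le; have [/forallP h|] := boolP [forall i, (al i < d)%N]; first exact: trE.
rewrite negb_forall => /existsP[i]; rewrite -leqNgt => hi.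
rewrite (_ : [forall i, _] = false) ?mul0r; last first.
  by apply/negbTE; rewrite negb_forall; apply/existsP; exists i; rewrite gtn_eqF.
rewrite Ft_sum mulr_sumr mulr_suml (scalar_sum tr_lin) big1 // => b _.
rewrite algZr algZl (scalar_Z tr_lin) (@tr_filt (wt al * delta + dgb b) (prb b)) ?mulr0 //.
exact: filt_mono le (filt_high hF hR chom Xd s hi (thom_tbasis hF b)).
Qed.

(** Discards the lower terms z produced by moving permutations across monomials. *)
Lemma tr_mon_filt al f D p z m : (wt al + m <= top)%N -> xfilt m D p z ->
  tr (xmon al * Ft f * z) = 0.
Proof.
move=> le hz.
rewrite Ft_sum mulr_sumr mulr_suml (scalar_sum tr_lin) big1 // => b _.
rewrite algZr algZl (scalar_Z tr_lin) -mulrA.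
by rewrite (tr_filt (filt_mono le (filt_monl hR al (filt_Fl hF hR (thom_tbasis hF b) hz)))) mulr0.
Qed.

Lemma wt_le al : (forall i, al i < d)%N -> (wt al <= top)%N.
Proof. by move=> h; rewrite /top -wt_const; apply: leq_sum => i _; rewrite -ltnS. Qed.

Lemma wt_top al : (forall i, al i < d)%N -> wt al = top -> al = cwt d'.
Proof.
move=> h E; apply: funext => i; apply/eqP.
have := leqif_sum (P := xpredT) (E1 := al) (E2 := cwt d') (C := fun i => al i == d')
  (fun i _ => leqif_eq (ltnSE (h i))).
by move=> [_]; rewrite -/(wt al) -/(wt (cwt d')) wt_const E eqxx => /esym/forallP/(_ i).
Qed.

(** Only leading terms matter, and those of both products are permuted into each other. *)
Lemma tr_S al b s s' : (forall i, al i < d)%N ->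
  tr (S s * xbas al b s') = tr (xbas al b s' * S s).
Proof.
move=> h; have le := wt_le h; have [z hz E] := S_mon hF hR s al.
rewrite /xbas -[in RHS]mulrA -(wSM hR) trE // !mulrA E !mulrDl (scalar_D tr_lin).
rewrite [X in _ + X](@tr_filt (wt al * delta + dgb b) (false (+) prb b)); last first.
  apply: filt_mono le _; apply: (filt_Sr hF hR); apply: (filt_Fr hF hR) => //; exact: thom_tbasis.
rewrite addr0 -[_ * S s * _]mulrA (wSF hR) mulrA -[_ * S s * _]mulrA -(wSM hR).
rewrite tr_top ?wt_perm // (ttr_tact hF).
have -> : [forall i, al ((s^-1)%g i) == d'] = [forall i, al i == d'].
  apply/forallP/forallP => H i; last exact: H.
  by rewrite -(permK s i); exact: H.
by rewrite -!eq_invg_mul; congr (_ * _%:R); rewrite eq_sym eq_invg_sym.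
Qed.

Lemma tact1 (f : T) : tact 1%g f = f.
Proof.
apply/ffunP => b; rewrite ffunE big1 => [|i _]; last first.
  rewrite big1 // => j /andP[lt]; rewrite !perm1 ltnNge ltnW //.
by rewrite expr0 mul1r; congr (f _); apply/ffunP => i; rewrite ffunE perm1.
Qed.

(** At the leading monomial f acquires psi^(d-1) when it passes x^a, and the Nakayama
relation of the tensor power adds one more psi. *)
Lemma tr_F D p f al b s : thom D p f -> (forall i, al i < d)%N ->
  tr (Ft f * xbas al b s) = (-1) ^+ (p && prb b) * tr (xbas al b s * Ft (tpsi_pow (cwt d) f)).
Proof.
move=> hf h; rewrite /xbas !mulrA (Ft_mon hF hR) -[_ * Ft (tbasis b)]mulrA -(wFM hR) trE //.
rewrite -[_ * S s * _]mulrA (wSF hR) !mulrA -[xmon al * _ * _]mulrA -(wFM hR) trE //.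
have [->|ne] := eqVneq s 1%g; last by rewrite !mulr0.
rewrite tact1 !mulr1; case: (boolP [forall i, _]) => [/forall_cwt ->|_]; last first.
  by rewrite !mul0r mulr0.
rewrite !mul1r (ttr_nakayama hF (tpsi_pow_hom hF hf) (thom_tbasis hF b)) tpsi_powD //.
Qed.

(** For adjacent i and i', moving s_i across x_i x_i' produces t_(i',i) and t_(i,i') on
the two sides of x_i', which cancel by [tpsi_tt]. *)
Lemma S_mon_top s m : S s * xmon (cwt m) = xmon (cwt m) * S s.
Proof.
elim/adjacent_gen: s => [|s s' h h'|i i' ii'].
- by rewrite (wS1 hR) mul1r mulr1.
- by rewrite (wSM hR) -mulrA h mulrA h' mulrA.
have lt : (i < i')%N by rewrite ii'.
have nij : i != i' by apply: contraTneq lt => ->; rewrite ltnn.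
pose s := tperm i i'; pose r (j : 'I_N) := if (j == i) || (j == i') then 0%N else m.
have sX : GRing.comm (S s) (X i * X i').
  rewrite /GRing.comm mulrA (wSX hR) // mulrBl -[_ * S _ * X i']mulrA (S_Xsucc hF hR) //.
  by rewrite (wFX hR) (tpsi_tt hF nij) mulrDr addrK mulrA (wXX hR i').
have sr : GRing.comm (S s) (xmon r).
  apply: commr_prod => j _; rewrite /r.
  have [->|ni] := eqVneq j i; first exact: commr1.
  have [->|ni'] := eqVneq j i'; first exact: commr1.
  by apply: commrX; apply: (wSX0 hR).
have -> : xmon (cwt m) = (X i * X i') ^+ m * xmon r.
  rewrite exprMn_comm; last exact: (wXX hR).
  rewrite -!(mon_Xn X) -!(mon_add hR); congr (mon _ _); apply: funext => j.
  rewrite /addw /r /cwt; case: eqVneq => [->|_] /=; first by rewrite (negbTE nij) !addn0.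
  by case: eqVneq => //= _; rewrite ?addn0.
by apply: commrM => //; apply: commrX.
Qed.

Lemma tpsi_pow_fixed al (U : T) : (forall i, tpsi i U = U) -> tpsi_pow al U = U.
Proof.
move=> H; elim/wt_ind: al => [|i al IH]; first by rewrite tpsi_pow0.
by rewrite -(tpsi_powD hF) IH -tpsiE.
Qed.

(** The exponent of (x_2 ... x_N)^(d-1). *)
Definition offw (j : 'I_N) : nat := if j == ord0 then 0%N else d'.

(** Since the c_m are fixed by all psi_i, they can be moved to the right of the monomial
without change. *)
Lemma X0_mon_top : X ord0 * xmon (cwt d') =
  \sum_(m < d) xmon (addw (fun j => if j == ord0 then m : nat else 0%N) offw) * Ft (c m).
Proof.
have -> : X ord0 * xmon (cwt d') = X ord0 ^+ d * xmon offw.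
  rewrite exprS -mulrA -(mon_Xn X) -(mon_add hR); congr (_ * mon _ _).
  by apply: funext => j; rewrite /addw /offw /cwt; case: eqP; rewrite ?addn0.
rewrite Xd mulr_suml; apply: eq_bigr => m _.
rewrite -mulrA (Ft_mon hF hR) tpsi_pow_fixed => [|i]; last exact: cpsi.
by rewrite mulrA -(mon_Xn X) -(mon_add hR).
Qed.

(** Only m = d - 1 gives the leading monomial. *)
Lemma tr_X0top f s :
  tr (X ord0 * xmon (cwt d') * Ft f * S s) = ttr (tmul (c d') f) * (s == 1%g)%:R.
Proof.
rewrite X0_mon_top 2!mulr_suml (scalar_sum tr_lin) (bigD1 (ord_max : 'I_d)) //=.
rewrite big1 ?addr0 => [|m ne].
  rewrite -[_ * Ft f]mulrA -(wFM hR) trE => [|i].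
    case: (boolP [forall i, _]) => [_|/negP[]]; first by rewrite mul1r.
    by apply/forallP => j; rewrite /addw /offw; case: (j == ord0); rewrite ?addn0.
  by rewrite /addw /offw; case: eqP; rewrite ?addn0.
rewrite -[_ * Ft f]mulrA -(wFM hR) trE => [|i].
  case: (boolP [forall i, _]) => [/forallP/(_ ord0)|_]; last by rewrite !mul0r.
  rewrite /addw /offw eqxx addn0 => /eqP E; case/eqP: ne; exact: val_inj.
by rewrite /addw /offw; case: eqP => _; rewrite ?addn0 ?add0n ?ltn_ord ?ltnSn.
Qed.

Lemma tr_S_gen s u D p : homGen (wGen X Ft S) D p u -> tr (S s * u) = tr (u * S s).
Proof.
move=> /(homGen_filt hF hR)[m] /(filt_reduce hF hR chom Xd).
elim=> {u} [_ [al [b [s' [h1 _ _ _ ->]]]]||a u v _ hu _ hv]; first exact: tr_S.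
- by rewrite mulr0 mul0r.
- by rewrite mulrDr mulrDl algZr algZl !tr_lin hu hv.
Qed.

(** Below the leading monomial this compares leading terms.  For x^a = M the element v is
rewritten with pi in front, where [tr_S_gen] moves it to the end, and both traces are given
by [tr_X0top]. *)
Lemma tr_X0 al b s : (forall i, al i < d)%N ->
  tr (X ord0 * xbas al b s) = tr (xbas al b s * X ord0).
Proof.
move=> h; have := wt_le h; rewrite leq_eqVlt => /orP[/eqP E|lt]; last first.
  have [z hz E] := S_X hF hR s ord0.
  rewrite /xbas -[in RHS]mulrA E mulrDr (scalar_D tr_lin).
  rewrite [X in _ = _ + X](tr_mon_filt _ _ hz) ?addr0; last by rewrite addn1.
  rewrite !mulrA -[_ * Ft _ * X _]mulrA (wFX hR) !mulrA -!(mon_unit X) -!(mon_add hR).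
  have le i : (wt al + wt (unit_wt i) <= top)%N by rewrite wt_unit addn1.
  rewrite !tr_top ?wt_add // 1?addnC // tpsiE (ttr_tpsi_pow hF).
  have [->|ne] := eqVneq s 1%g; last by rewrite !mulr0.
  rewrite perm1; congr ((nat_of_bool _)%:R * _ * _).
  by apply: eq_forallb => i; rewrite /addw addnC.
rewrite (wt_top h E) /xbas !mulrA tr_X0top.
pose e' := tact (s^-1)%g (tbasis b).
(* here the exponent is (d-1, ..., d-1) *)
have SV : S s * S (s^-1)%g = 1 by rewrite -(wSM hR) mulVg (wS1 hR).
have SV' : S (s^-1)%g * S s = 1 by rewrite -(wSM hR) mulgV (wS1 hR).
(* move the permutation to the front, so that it can be cycled to the end *)
have FS : Ft (tbasis b) * S s = S s * Ft e'.
  by rewrite -[Ft e']mulr1 -SV' [Ft e' * _]mulrA -(wSF hR) !mulrA SV mul1r.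
rewrite -[_ * S s]mulrA FS mulrA -S_mon_top -!mulrA (wFX hR) [xmon _ * _]mulrA.
have -> : xmon (cwt d') * X ord0 = X ord0 * xmon (cwt d').
  by rewrite -(mon_unit X) -!(mon_add hR); congr (mon _ _); apply: funext => i; rewrite /addw addnC.
have he : thom (dgb b) (prb b) (tpsi ord0 e').
  by rewrite tpsiE; apply/(tpsi_pow_hom hF)/thom_tact/(thom_tbasis hF).
rewrite (@tr_S_gen _ _ (delta + wt (cwt d') * delta + dgb b) (false (+) false (+) prb b));
    last first.
  apply: hom_mul; last by apply/hom_base/wGen_F.
  by apply: hom_mul; [exact/hom_base/wGen_X | exact: (homGen_mon hR)].
rewrite tr_X0top /e'; have [->|ne] := eqVneq s 1%g; last by rewrite !mulr0.
rewrite invg1 tact1; congr (_ * _).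
rewrite -{2}(cpsi ord0 (ltnSn d')) !tpsiE -(tpsi_pow_mul hF) (ttr_tpsi_pow hF) //.
Qed.

Definition bidx : finType := ({ffun 'I_N -> 'I_d} * idx * 'S_N)%type.
Definition bwt (j : bidx) : 'I_N -> nat := fun i => j.1.1 i.
Definition basis_vec (j : bidx) : R := xbas (bwt j) j.1.2 j.2.
(** The partner of x^a b pi, with the complementary exponent d - 1 - a. *)
Definition dual_vec (j : bidx) : R :=
  S (j.2^-1)%g * Ft (tdual j.1.2) * xmon (fun i => d' - bwt j i)%N.

(** The total degree of the product is at most [top], so the lower terms created by
moving a permutation across the complementary monomial do not contribute. *)
Lemma gram i j : (wt (bwt i) <= wt (bwt j))%N -> tr (basis_vec i * dual_vec j) = (i == j)%:R.
Proof.
case: i j => [[al b] s] [[al' b'] s']; rewrite /basis_vec /dual_vec /xbas /bwt /= => le.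
set be := fun i => (d' - al' i)%N; set a := (fun i => nat_of_ord (al i)).
have wbe : (wt (fun i => nat_of_ord (al' i)) + wt be)%N = top.
  rewrite -wt_add /top -(wt_const d'); congr wt; apply: funext => i.
  by rewrite /addw /be subnKC // -ltnS.
have SS : S s * S (s'^-1)%g = S (s'^-1 * s)%g by rewrite (wSM hR).
rewrite !mulrA -[_ * S s * _]mulrA SS; set rho := (_ * s)%g.
rewrite -[_ * S rho * _]mulrA (wSF hR) mulrA -[_ * S rho * _]mulrA.
have [z hz ->] := S_mon hF hR rho be.
rewrite -[xmon a * _ * Ft _]mulrA -(wFM hR) mulrDr (scalar_D tr_lin).
have le' : (wt a + wt be <= top)%N by rewrite -wbe leq_add2r.
rewrite [X in _ + X](tr_mon_filt _ le' hz) addr0.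
rewrite mulrA -[xmon a * _ * _]mulrA (Ft_mon hF hR) mulrA -(mon_add hR).
rewrite tr_top; last by rewrite wt_add wt_perm.
rewrite (ttr_tpsi_pow hF) /rho -eq_invg_mul invgK eq_sym.
rewrite !xpair_eqE.
have [Es|ne] := eqVneq s s'; last by rewrite andbF mulr0.
rewrite Es mulVg tact1 invg1 mulr1 andbT.
rewrite (tdual_dual hF) [b' == b]eq_sym.
have -> : [forall i, addw a (fun i0 => be ((1%g : 'S_N) i0)) i == d'] = (al == al').
  apply/forallP/eqP => [H|Ea i].
    apply/ffunP => i; apply: val_inj; move: (H i).
    rewrite /addw /be perm1 /a => /eqP E.
    have := ltn_ord (al' i); rewrite ltnS => le2.
    by apply/eqP; rewrite -(eqn_add2r (d' - al' i)) (subnKC le2); apply/eqP.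
  by rewrite /addw /be /a Ea perm1 subnKC // -ltnS.
by case: (al == al'); rewrite ?mul1r ?mul0r.
Qed.

End Trace.

(** * Graded Frobenius superalgebras from a triangular pairing *)

(** Square matrices over a commutative ring, indexed by a finite type. *)
Lemma fin_inverse_comm (k : comNzRingType) (J : finType) (A B : J -> J -> k) :
  (forall i j, \sum_l A i l * B l j = (i == j)%:R) ->
  forall i j, \sum_l B i l * A l j = (i == j)%:R.
Proof.
move=> H i j.
pose M (G : J -> J -> k) : 'M[k]_#|J| := \matrix_(a, b) G (enum_val a) (enum_val b).
have MM G G' : M G *m M G' = \matrix_(a, b) \sum_l G (enum_val a) l * G' l (enum_val b).
  apply/matrixP => a b; rewrite !mxE (reindex (@enum_val J predT)) /=; last first.
    by apply: onW_bij; apply: enum_val_bij.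
  by apply: eq_bigr => l _; rewrite !mxE.
have AB : M A *m M B = 1%:M.
  by rewrite MM; apply/matrixP => a b; rewrite !mxE H (inj_eq enum_val_inj).
have := mulmx1C AB; rewrite MM => /matrixP/(_ (enum_rank i) (enum_rank j)).
by rewrite !mxE !enum_rankK (inj_eq enum_rank_inj).
Qed.

Lemma fun_choice (A B : Type) (P : A -> B -> Prop) :
  (forall x, exists y, P x y) -> exists f, forall x, P x (f x).
Proof. by move=> /choice[f hf]; exists f. Qed.

Section GradedFrobenius.
Variables (k : comNzRingType) (R : pzAlg k) (h : nat -> bool -> R -> Prop).
Hypothesis h_zero : forall d p, h d p 0.
Hypothesis h_lin : forall d p c a b, h d p a -> h d p b -> h d p (c *: a + b).
Hypothesis h_one : h 0 false 1.
Hypothesis h_mul : forall d e p q a b, h d p a -> h e q b -> h (d + e)%N (p (+) q) (a * b).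
Variables (J : finType) (v w : J -> R) (dj : J -> nat) (pj : J -> bool) (ht : J -> nat).
Hypothesis v_hom : forall j, h (dj j) (pj j) (v j).
Hypothesis h_span : forall d p u, h d p u ->
  lspan (fun x => exists2 j, dj j = d /\ pj j = p & x = v j) u.
Hypothesis v_span : forall u, lspan (fun x => exists2 j, True & x = v j) u.
Variables (tr : R -> k) (D : nat).
Hypothesis tr_lin : scalar tr.
Hypothesis tr_hom : forall j, tr (v j) <> 0 -> dj j = D /\ pj j = false.
Hypothesis gram : forall i j, (ht i <= ht j)%N -> tr (v i * w j) = (i == j)%:R.

Lemma lspan_coef (P : J -> Prop) u : lspan (fun x => exists2 j, P j & x = v j) u ->
  exists2 c : J -> k, (forall j, c j <> 0 -> P j) & u = \sum_j c j *: v j.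
Proof.
elim=> {u} [_ [i Pi ->]||a u u' _ [c Pc ->] _ [c' Pc' ->]].
- exists (fun j => (j == i)%:R) => [j|]; first by case: eqP => [->|].
  by rewrite (bigD1 i) //= eqxx scale1r big1 ?addr0 // => j /negbTE ->; rewrite scale0r.
- by exists (fun _ => 0) => //; rewrite big1 // => j _; rewrite scale0r.
exists (fun j => a * c j + c' j) => [j|].
  have [E|/eqP /Pc //] := eqVneq (c j) 0; rewrite E mulr0 add0r; exact: Pc'.
by rewrite scaler_sumr -big_split; apply: eq_bigr => j _; rewrite scalerDl scalerA.
Qed.

Lemma tr_sumZ (c : J -> k) x : tr ((\sum_j c j *: v j) * x) = \sum_j c j * tr (v j * x).
Proof.
rewrite mulr_suml (scalar_sum tr_lin); apply: eq_bigr => j _.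
by rewrite algZl (scalar_Z tr_lin).
Qed.

Lemma tr_sumZr (c : J -> k) x : tr (x * (\sum_j c j *: v j)) = \sum_j c j * tr (x * v j).
Proof.
rewrite mulr_sumr (scalar_sum tr_lin); apply: eq_bigr => j _.
by rewrite algZr (scalar_Z tr_lin).
Qed.

(** Pair with the partner of an index of maximal height among those with nonzero
coefficient: all other terms vanish. *)
Lemma v_indep (c : J -> k) : (forall j, tr ((\sum_i c i *: v i) * w j) = 0) ->
  forall j, c j = 0.
Proof.
move=> H j; apply/eqP; apply: contraT => nj.
pose m := [arg max_(i > j | c i != 0) ht i].
have [i ni hi] : exists2 i, c i != 0 & forall i', c i' != 0 -> (ht i' <= ht i)%N.
  by exists m; rewrite /m; case: arg_maxnP.
have := H i; rewrite tr_sumZ (bigD1 i) //= gram // eqxx mulr1 big1 => [|i' ne].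
  by rewrite addr0 => /eqP; rewrite (negbTE ni).
have [->|n'] := eqVneq (c i') 0; first by rewrite mul0r.
by rewrite gram ?hi // (negbTE ne) mulr0.
Qed.

Lemma coords_ex : exists co : R -> J -> k, forall u, u = \sum_j co u j *: v j.
Proof.
apply: (fun_choice (P := fun u (c : J -> k) => u = \sum_j c j *: v j)) => u.
by have [c _ E] := lspan_coef (v_span u); exists c.
Qed.

Definition co : R -> J -> k := sval (cid coords_ex).
Lemma coE u : u = \sum_j co u j *: v j.
Proof. exact: (svalP (cid coords_ex)). Qed.

Lemma co_uniq (c : J -> k) u : u = \sum_j c j *: v j -> co u =1 c.
Proof.
move=> E j; apply/eqP; rewrite -subr_eq0; apply/eqP.
apply: (v_indep (c := fun j => co u j - c j)) => i.
have -> : \sum_j (co u j - c j) *: v j = 0.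
  under eq_bigr do rewrite scalerBl.
  by rewrite sumrB -coE -E subrr.
by rewrite mul0r (scalar_0 tr_lin).
Qed.

Lemma co_scalar j : scalar (co^~ j).
Proof.
move=> a u u'; rewrite (co_uniq (c := fun j => a * co u j + co u' j)) //.
rewrite {1}(coE u) {1}(coE u') scaler_sumr -big_split; apply: eq_bigr => i _.
by rewrite scalerDl scalerA.
Qed.

Lemma co_hom d p u j : h d p u -> co u j <> 0 -> dj j = d /\ pj j = p.
Proof.
move=> /h_span/lspan_coef [c Pc E]; rewrite (co_uniq E); exact: Pc.
Qed.

Lemma v_ext (V : lmodType k) (f g : R -> V) : linear f -> linear g ->
  (forall j, f (v j) = g (v j)) -> f =1 g.
Proof.
move=> lf lg H u; rewrite (coE u) (lin_sum lf) (lin_sum lg); apply: eq_bigr => j _.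
by rewrite (lin_Z lf) (lin_Z lg) H.
Qed.
Lemma v_ext_scalar (f g : R -> k) : scalar f -> scalar g ->
  (forall j, f (v j) = g (v j)) -> f =1 g.
Proof. move=> lf lg; exact: (@v_ext k^o f g lf lg). Qed.

(** The coordinates of a homogeneous element are supported on the basis elements of its
degree and parity, so the pieces are spanned by disjoint parts of the basis. *)
Lemma graded_of_basis : graded_superalgebra h.
Proof.
have hs d p (P : pred J) (c : J -> k) :
    (forall j, P j -> dj j = d /\ pj j = p) -> h d p (\sum_(j | P j) c j *: v j).
  move=> H; elim/big_rec: _ => [|j x Pj hx]; first exact: h_zero.
  by apply: h_lin => //; have [<- <-] := H j Pj.
split=> // [u|N c hc E d p ltd].
  pose N := (\max_j dj j).+1.
  have ltN j : (dj j < N)%N by rewrite ltnS leq_bigmax.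
  exists N, (fun d p => \sum_(j | (dj j == d) && (pj j == p)) co u j *: v j).
  split=> [d p|]; first by apply: hs => j /andP[/eqP ? /eqP ?].
  rewrite {1}(coE u) pair_bigA /=.
  rewrite (partition_big (fun j => (Ordinal (ltN j), pj j)) xpredT) //=.
have co0 j : co 0 j = 0 by exact: (scalar_0 (co_scalar j)).
rewrite (coE (c d p)) big1 // => j _.
have [->|/eqP ne] := eqVneq (co (c d p) j) 0; first by rewrite scale0r.
have [Ed Ep] := co_hom (hc d p) ne; case: ne.
have := congr1 (co^~ j) E; rewrite /= co0 (scalar_sum (co_scalar j)).
rewrite (bigD1 (Ordinal ltd)) //= (scalar_sum (co_scalar j)) (bigD1 p) //=.
rewrite big1 => [|q nq]; last first.
  apply: contrapT => /(co_hom (hc _ _))[_ E2]; move: nq.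
  by rewrite -E2 Ep eqxx.
rewrite addr0 big1 ?addr0 // => e ne; rewrite (scalar_sum (co_scalar j)) big1 // => q _.
apply: contrapT => /(co_hom (hc _ _))[E1 _]; move: ne.
by rewrite -val_eqE /= -E1 Ed eqxx.
Qed.

Lemma tr_homogeneous d p u : h d p u -> tr u <> 0 -> d = D /\ p = false.
Proof.
move=> hu; have [/existsP[j /andP[/eqP n1 /eqP n2]] _|] :=
    boolP [exists j, (co u j != 0) && (tr (v j) != 0)].
  have [<- <-] := co_hom hu n1; exact: tr_hom.
rewrite negb_exists => /forallP H; case.
rewrite (coE u) (scalar_sum tr_lin) big1 // => j _; rewrite (scalar_Z tr_lin).
have := H j; rewrite negb_and !negbK => /orP[/eqP ->|/eqP ->]; first by rewrite mul0r.
by rewrite mulr0.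
Qed.

Lemma tr_mul_parity d e p q u u' : h d p u -> h e q u' -> tr (u * u') <> 0 -> p = q.
Proof.
move=> hu hu' /(tr_homogeneous (h_mul hu hu'))[_]; by case: p q {hu hu'} => [] [].
Qed.

(** Forward substitution: solve for the values at indices of height < m, then correct at
height m by multiples of the w j, which pair to zero with the smaller heights. *)
Lemma tr_surj (phi : J -> k) : exists f, forall j, tr (v j * f) = phi j.
Proof.
suff H m : exists f, forall j, (ht j < m)%N -> tr (v j * f) = phi j.
  have [f hf] := H (\max_j ht j).+1; exists f => j; apply: hf.
  by rewrite ltnS leq_bigmax.
elim: m => [|m [f hf]]; first by exists 0.
exists (f + \sum_(j | ht j == m) (phi j - tr (v j * f)) *: w j) => j; rewrite ltnS => le.
have E i : ht i == m -> tr (v j * ((phi i - tr (v i * f)) *: w i)) =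
    (phi i - tr (v i * f)) * (j == i)%:R.
  by move=> /eqP Ei; rewrite algZr (scalar_Z tr_lin) gram // Ei.
rewrite mulrDr (scalar_D tr_lin) mulr_sumr (scalar_sum tr_lin) (eq_bigr _ E).
have [lt|ge] := ltnP (ht j) m.
  rewrite hf // big1 ?addr0 // => i /eqP Ei; case: eqP => [ji|_]; last by rewrite mulr0.
  by move: lt; rewrite ji Ei ltnn.
have Ej : ht j == m by rewrite eqn_leq le.
rewrite (bigD1 j) //= eqxx mulr1 big1 ?addr0 => [|i /andP[_ ne]].
  by rewrite addrC subrK.
by rewrite eq_sym (negbTE ne) mulr0.
Qed.

Lemma dual_ex : exists r : J -> R, forall j i, tr (v i * r j) = (i == j)%:R.
Proof.
by apply: (fun_choice (P := fun j r => forall i, tr (v i * r) = (i == j)%:R)) => j; exact: tr_surj.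
Qed.

(** The right dual family exists by [tr_surj]; its coordinates form a right inverse of
the Gram matrix of the basis, hence a two-sided one.  All nondegeneracy statements
follow from this. *)
Lemma form_inv : exists B : J -> J -> k,
  (forall i j, \sum_l tr (v i * v l) * B l j = (i == j)%:R) /\
  (forall i j, \sum_l B i l * tr (v l * v j) = (i == j)%:R).
Proof.
have [r hr] := dual_ex; exists (fun l j => co (r j) l).
have H i j : \sum_l tr (v i * v l) * co (r j) l = (i == j)%:R.
  rewrite -hr [in RHS](coE (r j)) tr_sumZr; apply: eq_bigr => l _; exact: mulrC.
by split=> //; apply: fin_inverse_comm H.
Qed.

Lemma tr_nondeg f g : (forall j, tr (v j * f) = tr (v j * g)) -> f = g.
Proof.
have [B [_ BA]] := form_inv => H.
have K x i : co x i = \sum_l B i l * tr (v l * x).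
  rewrite [in RHS](coE x); under [RHS]eq_bigr do rewrite tr_sumZr mulr_sumr.
  rewrite exchange_big /=.
  have E j : \sum_l B i l * (co x j * tr (v l * v j)) = co x j * (i == j)%:R.
    by rewrite -BA mulr_sumr; apply: eq_bigr => l _; rewrite mulrCA.
  rewrite (eq_bigr _ (fun j _ => E j)) (bigD1 i) //= eqxx mulr1 big1 ?addr0 // => j ne.
  by rewrite eq_sym (negbTE ne) mulr0.
rewrite (coE f) (coE g); apply: eq_bigr => i _; congr (_ *: _).
by rewrite !K; apply: eq_bigr => l _; rewrite H.
Qed.

Lemma tr_nondegl f g : (forall j, tr (f * v j) = tr (g * v j)) -> f = g.
Proof.
move=> H; rewrite (coE f) (coE g); apply: eq_bigr => i _; congr (_ *: _).
apply/eqP; rewrite -subr_eq0; apply/eqP.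
apply: (v_indep (c := fun j => co f j - co g j)) => {}i.
have -> : \sum_j (co f j - co g j) *: v j = f - g.
  by under eq_bigr do rewrite scalerBl; rewrite sumrB -!coE.
rewrite mulrBl (scalar_B tr_lin) (coE (w i)) !tr_sumZr.
by apply/eqP; rewrite subr_eq0; apply/eqP/eq_bigr => j _; rewrite H.
Qed.

Lemma tr_surjl (phi : J -> k) : exists f, forall j, tr (f * v j) = phi j.
Proof.
have [B [_ BA]] := form_inv.
exists (\sum_i (\sum_l phi l * B l i) *: v i) => j.
rewrite tr_sumZ; under eq_bigr do rewrite mulr_suml.
rewrite exchange_big /=.
have E l : \sum_i phi l * B l i * tr (v i * v j) = phi l * (l == j)%:R.
  by rewrite -BA mulr_sumr; apply: eq_bigr => i _; rewrite mulrA.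
rewrite (eq_bigr _ (fun l _ => E l)) (bigD1 j) //= eqxx mulr1 big1 ?addr0 // => i ne.
by rewrite (negbTE ne) mulr0.
Qed.

(** The parity involution.  The signed form of the definition of a Frobenius superalgebra
is tr (g * sgn f), which needs no decomposition into homogeneous parts. *)
Definition sgn (u : R) : R := \sum_j ((-1) ^+ pj j * co u j) *: v j.

Lemma sgn_linear : linear sgn.
Proof.
move=> a u u'; rewrite /sgn scaler_sumr -big_split; apply: eq_bigr => j _ /=.
by rewrite co_scalar scalerA -scalerDl mulrDr mulrCA.
Qed.

Lemma sgn_hom d p u : h d p u -> sgn u = (-1) ^+ p *: u.
Proof.
move=> hu; rewrite [in RHS](coE u) scaler_sumr; apply: eq_bigr => j _; rewrite scalerA.
have [->|/eqP ne] := eqVneq (co u j) 0; first by rewrite !mulr0.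
by have [_ ->] := co_hom hu ne.
Qed.

Lemma sgn_v j : sgn (v j) = (-1) ^+ pj j *: v j.
Proof. exact: sgn_hom (v_hom j). Qed.

Lemma sgnK : involutive sgn.
Proof.
apply: v_ext => [a u u'|//|j]; first by rewrite !sgn_linear.
by rewrite sgn_v (lin_Z sgn_linear) sgn_v scalerA -signr_addb addbb scale1r.
Qed.

Lemma sgnM u u' : sgn (u * u') = sgn u * sgn u'.
Proof.
apply: (v_ext (f := fun u => sgn (u * u')) (g := fun u => sgn u * sgn u')) => [a x y|a x y|i].
- by rewrite mulrDl algZl sgn_linear.
- by rewrite sgn_linear mulrDl algZl.
apply: (v_ext (f := fun u' => sgn (v i * u'))
  (g := fun u' => sgn (v i) * sgn u')) => [a x y|a x y|j].
- by rewrite mulrDr algZr sgn_linear.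
- by rewrite sgn_linear mulrDr algZr.
by rewrite (sgn_hom (h_mul (v_hom i) (v_hom j))) !sgn_v algZl algZr scalerA signr_addb.
Qed.

Lemma tr_sgn u : tr (sgn u) = tr u.
Proof.
apply: (v_ext_scalar (f := fun u => tr (sgn u)) (g := tr)) => [a x y||j] //.
  by rewrite sgn_linear tr_lin.
rewrite sgn_v (scalar_Z tr_lin).
have [->|/eqP ne] := eqVneq (tr (v j)) 0; first by rewrite mulr0.
by have [_ ->] := tr_hom ne; rewrite mul1r.
Qed.

Lemma frobenius_of_gram : graded_frobenius h tr.
Proof.
split=> //.
- exact: graded_of_basis.
- by move=> d a ha; apply: contrapT => /(tr_homogeneous ha)[].
- by exists D => d p a ha ne; apply: contrapT => /(tr_homogeneous ha)[/ne].
exists (fun f g => tr (g * sgn f)); split=> [f a x y|g a x y|d e p q f g hf hg|phi hphi].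
- by rewrite mulrDl algZl tr_lin.
- by rewrite sgn_linear mulrDr algZr tr_lin.
- rewrite (sgn_hom hf) algZr (scalar_Z tr_lin).
  have [->|/eqP ne] := eqVneq (tr (g * f)) 0; first by rewrite !mulr0.
  by rewrite (tr_mul_parity hg hf ne) andbb.
have [f hf] := tr_surj (fun j => phi (v j)); exists (sgn f); split=> [|f' hf'].
  apply: v_ext_scalar => [a x y||j] //; last by rewrite sgnK hf.
  by rewrite mulrDl algZl tr_lin.
by rewrite -[f']sgnK; congr sgn; apply: tr_nondeg => j; rewrite hf hf'.
Qed.

(** The automorphism is defined by tr (x * Psi u) = tr (u * sgn x).  By nondegeneracy it
is linear, multiplicative and bijective, and it is recognised on a homogeneous u by
pairing with the basis. *)
Lemma nakayama_of_gram : exists Psi : R -> R, is_nakayama h tr Psi /\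
  forall d p u u', h d p u ->
    (forall j, tr (u * v j) = (-1) ^+ (p && pj j) * tr (v j * u')) -> Psi u = u'.
Proof.
have sgn_tr u : scalar (fun x => tr (u * sgn x)).
  by move=> a x y; rewrite sgn_linear mulrDr algZr tr_lin.
have trl (u : R) : scalar (fun x : R => tr (x * u)) by move=> a x y; rewrite mulrDl algZl tr_lin.
have [Psi PsiP] : exists Psi : R -> R, forall u x, tr (x * Psi u) = tr (u * sgn x).
  apply: (fun_choice (P := fun u y => forall x, tr (x * y) = tr (u * sgn x))) => u.
  have [f hf] := tr_surj (fun j => tr (u * sgn (v j))); exists f.
  by apply: v_ext_scalar.
have [Psi' Psi'P] : exists Psi' : R -> R, forall u x, tr (Psi' u * sgn x) = tr (x * u).
  apply: (fun_choice (P := fun u y => forall x, tr (y * sgn x) = tr (x * u))) => u.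
  have [f hf] := tr_surjl (fun j => (-1) ^+ pj j * tr (v j * u)); exists f.
  apply: v_ext_scalar => // j.
  by rewrite sgn_v algZr (scalar_Z tr_lin) hf mulrA -signr_addb addbb mul1r.
exists Psi; split; last first.
  move=> d p u u' hu H; apply: tr_nondeg => j; rewrite PsiP sgn_v algZr (scalar_Z tr_lin).
  have [E|/eqP ne] := eqVneq (tr (u * v j)) 0.
    have := H j; rewrite E mulr0 => /(congr1 ( *%R ((-1) ^+ (p && pj j)))).
    by rewrite mulr0 mulrA -signr_addb addbb mul1r.
  rewrite H mulrA; move: (tr_mul_parity hu (v_hom j) ne) => <-.
  by rewrite andbb -signr_addb addbb mul1r.
split.
- move=> a u u'; apply: tr_nondeg => j.
  by rewrite PsiP mulrDr algZr mulrDl algZl !tr_lin !PsiP.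
- split.
    apply: tr_nondeg => j.
    by rewrite PsiP mul1r tr_sgn mulr1.
  move=> u u'; apply: tr_nondeg => j; rewrite PsiP [in RHS]mulrA PsiP.
  by rewrite -[RHS]tr_sgn sgnM sgnK mulrA PsiP sgnM sgnK mulrA.
- exists Psi' => u.
    by apply: tr_nondegl => j; rewrite -[v j]sgnK Psi'P PsiP.
  by apply: tr_nondeg => j; rewrite PsiP Psi'P.
move=> d e p q f g hf hg; rewrite PsiP (sgn_hom hg) algZr (scalar_Z tr_lin) mulrA.
have [->|/eqP ne] := eqVneq (tr (f * g)) 0; first by rewrite mulr0.
by rewrite (tr_mul_parity hf hg ne) andbb -signr_addb addbb mul1r.
Qed.

End GradedFrobenius.

(** * Quotients of free algebras *)

Lemma freeAlg_ind (k : comNzRingType) (G : choiceType) (P : freeAlg k G -> Prop) :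
  P 0 -> P 1 -> (forall x y, P x -> P y -> P (x + y)) ->
  (forall a x, P x -> P (a *: x)) -> (forall g x, P x -> P (freeGen k g * x)) ->
  forall x, P x.
Proof.
move=> P0 P1 PD PZ PG x.
pose U (m : {fmonom G}) (a : k) : freeAlg k G := mkmalgU m a.
have UU (a b : k) (m1 m2 : {fmonom G}) : U m1 a * U m2 b = U (mmul m1 m2) (a * b).
  exact: fgmulUU.
have E (a : k) m : U m a = a *: U m 1.
  by rewrite algZE -[alg_in _ a]/(U mone a) UU mul1m mulr1.
rewrite (monalgE x); elim/big_ind: _ => // m _.
rewrite -/(U _ _) E; apply: PZ; case: m => s; elim: s => [|g s IH].
  by rewrite -fmoneE; exact: P1.
have -> : U (FMonom (g :: s)) 1 = freeGen k g * U (FMonom s) 1.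
  rewrite -[freeGen k g]/(U (fmu g) 1) UU mulr1; congr (U _ _).
  by apply/eqP; rewrite -val_eqE /= fmM fmU.
exact: PG.
Qed.

Section QuotMap.
Variables (k : comNzRingType) (A : pzAlg k) (I : A -> Prop).
Notation q := (quotMap I).

Lemma quotMapD x y : q (x + y) = q x + q y.
Proof. by rewrite -[RHS]/(qadd _ _) qaddE. Qed.
Lemma quotMapM x y : q (x * y) = q x * q y.
Proof. by rewrite -[RHS]/(qmul _ _) qmulE. Qed.
Lemma quotMap1 : q 1 = 1.
Proof. by []. Qed.
Lemma quotMapZ a x : q (a *: x) = a *: q x.
Proof. by rewrite !algZE quotMapM. Qed.
Lemma quotMap_linear : linear q.
Proof. by move=> a x y; rewrite quotMapD quotMapZ. Qed.
Lemma quotMapB x y : q (x - y) = q x - q y.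
Proof. by rewrite quotMapD -scaleN1r quotMapZ scaleN1r. Qed.
Lemma quotMap_rel x : I x -> q x = 0.
Proof.
move=> Ix; apply: (proj1 (quotPiP I x 0)); rewrite subr0; exact: ideal_base.
Qed.
Lemma quotMap_eq x y : I (x - y) -> q x = q y.
Proof. by move=> /quotMap_rel; rewrite quotMapB => /eqP; rewrite subr_eq0 => /eqP. Qed.
Lemma quotMapX x m : q (x ^+ m) = q x ^+ m.
Proof. by elim: m => [|m IH]; rewrite ?expr0 // !exprS quotMapM IH. Qed.
Lemma quotMap_prod J (r : seq J) (P : pred J) (E : J -> A) :
  q (\prod_(i <- r | P i) E i) = \prod_(i <- r | P i) q (E i).
Proof. exact: (big_morph q quotMapM quotMap1). Qed.
Lemma quotMap_surj u : exists x, u = q x.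
Proof. by elim/quotPi_ind: u => x; exists x. Qed.
End QuotMap.

(** * Monic polynomials in the first variable *)

Section Monic.
Variables (k : comNzRingType) (F : frobData k) (n : nat) (R : pzAlg k).
Hypothesis hF : is_frobData F.
Notation N := n.+1.
Notation delta := (fDelta F).
Variables (X : 'I_N -> R) (Ft : tpow F N -> R) (S : 'S_N -> R).
Hypothesis hR : wreath_rels X Ft S.

(** Coefficients of x_1^m in a monic polynomial of x_1-degree a that is homogeneous of
degree a times that of x_1.  Being fixed by the psi_i makes them commute with x_1. *)
Definition lower_coef (a m : nat) (f : tpow F N) : Prop :=
  [/\ (m < a)%N, thom ((a - m) * delta) false f & forall i, tpsi i f = f].

Definition lower_X1 (a : nat) : R -> Prop := lspan (fun u => exists m f,
  lower_coef a m f /\ u = X ord0 ^+ m * Ft f).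

Definition monic_X1 (a : nat) (u : R) : Prop := lower_X1 a (u - X ord0 ^+ a).

Lemma Ft_X0 f m : (forall i, tpsi i f = f) -> Ft f * X ord0 ^+ m = X ord0 ^+ m * Ft f.
Proof.
move=> hf; elim: m => [|m IH]; first by rewrite mulr1 mul1r.
by rewrite exprS mulrA (wFX hR) hf -mulrA IH mulrA.
Qed.

Lemma lower_X1_Xl a b u : lower_X1 b u -> lower_X1 (a + b) (X ord0 ^+ a * u).
Proof.
apply: (lspan_map (mull_linear _)) => _ [m [f [[h1 h2 h3] ->]]].
apply: lspan_base; exists (a + m)%N, f; split; last by rewrite exprD mulrA.
by split; rewrite ?ltn_add2l ?subnDl.
Qed.

Lemma lower_X1_Xr a b u : lower_X1 a u -> lower_X1 (a + b) (u * X ord0 ^+ b).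
Proof.
apply: (lspan_map (mulr_linear _)) => _ [m [f [[h1 h2 h3] ->]]].
apply: lspan_base; exists (m + b)%N, f; split; last by rewrite -mulrA Ft_X0 // mulrA exprD.
by split; rewrite ?ltn_add2r ?subnDr.
Qed.

Lemma lower_X1_mul a b u v : lower_X1 a u -> lower_X1 b v -> lower_X1 (a + b) (u * v).
Proof.
move=> hu; apply: (lspan_map (mull_linear _)) => _ [m [f [[h1 h2 h3] ->]]].
move: hu; apply: (lspan_map (mulr_linear _)) => _ [m' [f' [[h1' h2' h3'] ->]]].
apply: lspan_base; exists (m' + m)%N, (tmul f' f); split; last first.
  by rewrite (wFM hR) exprD !mulrA -[_ * Ft f' * _]mulrA Ft_X0 // !mulrA.
split.
- by rewrite -addSn leq_add // ltnW.
- rewrite (_ : (a + b - (m' + m)) * delta = (a - m') * delta + (b - m) * delta)%N.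
    by rewrite -[false]/(false (+) false); apply: thom_mul.
  by rewrite -mulnDl; congr (_ * _)%N; rewrite subnDA -addnBAC ?addnBA // ltnW.
- by move=> i; rewrite tpsiE (tpsi_pow_mul hF) -!tpsiE h3 h3'.
Qed.

(** Expand (x^a + lower)(x^b + lower). *)
Lemma monic_X1M a b u v : monic_X1 a u -> monic_X1 b v -> monic_X1 (a + b) (u * v).
Proof.
rewrite /monic_X1 => hu hv.
have -> : u * v - X ord0 ^+ (a + b) =
    (u - X ord0 ^+ a) * (v - X ord0 ^+ b) + (u - X ord0 ^+ a) * X ord0 ^+ b
    + X ord0 ^+ a * (v - X ord0 ^+ b).
  by rewrite -mulrDr subrK mulrBl mulrBr exprD addrA subrK.
by apply: lspanD; [apply: lspanD; [apply: lower_X1_mul | apply: lower_X1_Xr] | apply: lower_X1_Xl].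
Qed.

Lemma monic_X1_one : monic_X1 0 1.
Proof. by rewrite /monic_X1 expr0 subrr; apply: lspan0. Qed.

Lemma monic_X1_base m f : (0 < m)%N -> thom (m * delta) false f -> (forall i, tpsi i f = f) ->
  monic_X1 m (X ord0 ^+ m - Ft f).
Proof.
move=> m0 hf hp; rewrite /monic_X1 addrC addrA addNr add0r -[Ft f]mul1r -(expr0 (X ord0)).
by apply/lspanN/lspan_base; exists 0%N, f; split=> //; split; rewrite ?subn0.
Qed.

(** A monic polynomial that vanishes is a reduction rule for x_1^d. *)
Lemma monic_X1_zero d : monic_X1 d 0 -> exists c : nat -> tpow F N,
  [/\ forall m, (m < d)%N -> thom ((d - m) * delta) false (c m),
      forall m i, (m < d)%N -> tpsi i (c m) = c m
    & X ord0 ^+ d = \sum_(m < d) X ord0 ^+ m * Ft (c m)].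
Proof.
rewrite /monic_X1 sub0r => /lspanN; rewrite opprK.
elim=> {}[u [m [f [[h1 h2 h3] ->]]]||x u v _ [c [h1 h2 ->]] _ [c' [h1' h2' ->]]].
- exists (fun j => if j == m then f else 0); split=> [j lt|j i lt|].
  + by case: eqP => [->|] //; move=> _; apply: thom0.
  + case: eqP => // _; rewrite tpsiE; exact: (lin_0 (tpsi_pow_linear _)).
  + rewrite (bigD1 (Ordinal h1)) //= eqxx big1 ?addr0 // => j ne.
    by rewrite -val_eqE /= in ne; rewrite (negbTE ne) (lin_0 (wFlin hR)) mulr0.
- exists (fun _ => 0); split=> [j _|j i _|]; first exact: thom0.
    by rewrite tpsiE; exact: (lin_0 (tpsi_pow_linear _)).
  by rewrite big1 // => j _; rewrite (lin_0 (wFlin hR)) mulr0.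
exists (fun j => x *: c j + c' j); split=> [j lt|j i lt|].
- by apply: thom_lin; [apply: h1 | apply: h1'].
- by rewrite (tpsi_linear) h2 // h2'.
- rewrite scaler_sumr -big_split; apply: eq_bigr => j _ /=.
  by rewrite (wFlin hR) mulrDr algZr.
Qed.
End Monic.

(** * The Frobenius property and the Nakayama automorphism *)

Section Abstract.
Variables (k : comNzRingType) (F : frobData k) (n : nat) (R : pzAlg k).
Hypothesis hF : is_frobData F.
Notation N := n.+1.
Notation delta := (fDelta F).
Variables (X : 'I_N -> R) (Ft : tpow F N -> R) (S : 'S_N -> R).
Hypothesis hR : wreath_rels X Ft S.
Notation hom := (homGen (wGen X Ft S)).
Hypothesis hgen : forall u : R, lspan (fun v => exists D p, hom D p v) u.
Variables (tr : R -> k).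
Hypothesis tr_lin : scalar tr.

Definition frobenius_spec d : Prop :=
  graded_frobenius hom tr /\ exists Psi : R -> R,
    [/\ is_nakayama hom tr Psi, forall i, Psi (X i) = X i,
        forall f, Psi (Ft f) = Ft (tpsi_pow (fun _ => d) f) & forall s, Psi (S s) = S s].

Lemma gen_span (P : R -> Prop) :
  (forall D p u, hom D p u -> lspan P u) -> forall u, lspan P u.
Proof. by move=> H u; apply: lspan_trans (hgen u) => v [D [p /H]]. Qed.

(** At level 0 the relation says 1 = 0, and the empty family is a basis. *)
Lemma frobenius_level0 : X ord0 ^+ 0 = 0 -> frobenius_spec 0.
Proof.
rewrite expr0 => E10.
have all0 (u v : R) : u = v by rewrite -[u]mulr1 -[v]mulr1 E10 !mulr0.
pose v0 : void -> R := fun j => match j with end.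
have sp (P : R -> Prop) u : lspan P u by rewrite (all0 u 0); apply: lspan0.
pose z := fun _ : void => 0%N; pose b := fun _ : void => false.
have vh j : hom (z j) (b j) (v0 j) by case: j.
have th j : tr (v0 j) <> 0 -> z j = 0%N /\ b j = false by case: j.
have gr i j : (z i <= z j)%N -> tr (v0 i * v0 j) = (i == j)%:R by case: i.
have sp1 D p u : hom D p u -> lspan (fun x => exists2 j, z j = D /\ b j = p & x = v0 j) u.
  by move=> _; apply: sp.
have sp2 u : lspan (fun x => exists2 j, True & x = v0 j) u by apply: sp.
split.
  exact: (frobenius_of_gram (@hom_zero _ _ _) (@hom_lin _ _ _) (@hom_one _ _ _)
    (@hom_mul _ _ _) vh sp1 sp2 tr_lin th gr).
have [Psi [H _]] := nakayama_of_gram (@hom_mul _ _ _) vh sp1 sp2 tr_lin th gr.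
by exists Psi; split.
Qed.

Section PositiveLevel.
Variables (d' : nat) (c : nat -> tpow F N).
Notation d := d'.+1.
Hypothesis chom : forall m, (m < d)%N -> thom ((d - m) * delta) false (c m).
Hypothesis cpsi : forall m i, (m < d)%N -> tpsi i (c m) = c m.
Hypothesis Xd : X ord0 ^+ d = \sum_(m < d) X ord0 ^+ m * Ft (c m).
Hypothesis trE : forall (al : 'I_N -> nat) f s, (forall i, al i < d)%N ->
  tr (mon X al * Ft f * S s) = [forall i, al i == d']%:R * ttr f * (s == 1%g)%:R.

Notation J := (bidx F n d').
Notation v := (basis_vec X Ft S (d' := d')).

Let dj (j : J) : nat := (wt (bwt j) * delta + dgb j.1.2)%N.
Let pj (j : J) : bool := prb j.1.2.

Lemma bwt_lt (j : J) i : (bwt j i < d)%N.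
Proof. exact: ltn_ord. Qed.

Lemma bas_basis_vec al b s : (forall i, al i < d)%N ->
  exists j : J, [/\ bwt j = al, j.1.2 = b & j.2 = s].
Proof.
move=> h; exists ([ffun i => Ordinal (h i)], b, s); split=> //.
by apply: funext => i; rewrite /bwt /= ffunE.
Qed.

Lemma hom_span D p u : hom D p u ->
  lspan (fun x => exists2 j, dj j = D /\ pj j = p & x = v j) u.
Proof.
move=> /(homGen_filt hF hR)[m] /(filt_reduce hF hR chom Xd).
apply: lspan_trans => _ [al [b [s [h1 _ h2 h3 ->]]]].
have [j [E1 E2 E3]] := bas_basis_vec b s h1.
by apply: lspan_base; exists j; rewrite /dj /pj /basis_vec ?E1 ?E2 ?E3.
Qed.

(** A nonzero trace forces the leading exponent and factors of trace degree. *)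
Lemma tr_basis_vec (j : J) : tr (v j) <> 0 -> dj j = (N * d' * delta + N * delta)%N /\ pj j = false.
Proof.
rewrite /basis_vec /bas trE => [|i]; last exact: bwt_lt.
case: (boolP [forall i, _]) => [/forall_cwt E|_]; last by rewrite !mul0r.
rewrite mul1r => ne; have ne' : ttr (tbasis j.1.2) <> 0 by move=> E0; apply: ne; rewrite E0 mul0r.
rewrite /tbasis (ttr_pure hF) in ne'.
have nei i : fTr F (fB F (j.1.2 i)) <> 0.
  by move=> E0; apply: ne'; rewrite (bigD1 i) //= E0 mul0r.
rewrite /dj /pj E wt_const /dgb /prb; split.
  congr (_ + _)%N; rewrite -[X in (X * _)%N](card_ord N) -sum_nat_const.
  by apply: eq_bigr => i _; exact: (tr_degree hF (fB_hom hF (j.1.2 i)) (nei i)).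
by rewrite big1 // => i _; rewrite (tr_parity hF (fB_hom hF _) (nei i)).
Qed.

Lemma frobenius_pos : frobenius_spec d.
Proof.
have vs u : lspan (fun x => exists2 j, True & x = v j) u.
  apply: gen_span => D p x /hom_span; apply: lspan_trans => _ [j _ ->].
  by apply: lspan_base; exists j.
have vh j : hom (dj j) (pj j) (v j) by exact: homGen_bas.
have gr := gram hF hR chom Xd tr_lin trE.
split.
  exact: (frobenius_of_gram (@hom_zero _ _ _) (@hom_lin _ _ _) (@hom_one _ _ _)
    (@hom_mul _ _ _) vh hom_span vs tr_lin tr_basis_vec gr).
have [Psi [nPsi genP]] := nakayama_of_gram
    (@hom_mul _ _ _) vh hom_span vs tr_lin tr_basis_vec gr.
have [lPsi [Psi1 PsiM] _ _] := nPsi.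
have PF f : Psi (Ft f) = Ft (tpsi_pow (fun _ => d) f).
  apply: (tpow_ext hF (G := fun f => Psi (Ft f))
    (H := fun f => Ft (tpsi_pow _ f))) => [a x y|a x y|b].
  - by rewrite (wFlin hR) lPsi.
  - by rewrite tpsi_pow_linear (wFlin hR).
  apply: (genP (dgb b) (prb b)); first exact/hom_base/wGen_F/(thom_tbasis hF).
  by move=> j; apply: (tr_F hF hR trE); [exact: thom_tbasis | exact: bwt_lt].
have PS s : Psi (S s) = S s.
  apply: (genP 0%N false); first exact/hom_base/wGen_S.
  by move=> j; rewrite mul1r; apply: (tr_S hF hR chom Xd tr_lin trE); exact: bwt_lt.
have PX0 : Psi (X ord0) = X ord0.
  apply: (genP delta false); first exact/hom_base/wGen_X.
  by move=> j; rewrite mul1r; apply: (tr_X0 hF hR chom cpsi Xd tr_lin trE); exact: bwt_lt.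
exists Psi; split=> // -[m]; elim: m => [|m IH] lt.
  by rewrite (_ : Ordinal lt = ord0) //; apply: val_inj.
pose i := Ordinal (ltnW lt : (m < N)%N).
have nij : i != Ordinal lt by rewrite -val_eqE /= neq_ltn ltnSn.
rewrite (X_succ hR (i := i)) // PsiM PS; congr (_ * _).
by rewrite (lin_D lPsi) PsiM PS (IH (ltnW lt)) PF (tpsi_powc_tt hF).
Qed.
End PositiveLevel.

Lemma nakayama_id_of_fixed Psi : is_nakayama hom tr Psi ->
  (forall i, Psi (X i) = X i) -> (forall f, Psi (Ft f) = Ft f) -> (forall s, Psi (S s) = S s) ->
  is_nakayama hom tr id.
Proof.
move=> nPsi PX PF PS; have [lPsi [P1 PM] _ _] := nPsi.
suff : Psi = id by move=> <-.
apply: funext => u; elim: {u}(hgen u) => [u [D [p hu]]||a u v _ hu _ hv].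
- elim: hu => {D p u} [D p _ [i|D' p' f _|s]|||D p a u v _ hu _ hv|D D' p p' u v _ hu _ hv] //.
  + by move=> D p; exact: (lin_0 lPsi).
  + by rewrite lPsi hu hv.
  + by rewrite PM hu hv.
- exact: (lin_0 lPsi).
- by rewrite lPsi hu hv.
Qed.
End Abstract.

(** * The cyclotomic quotient *)

Section Concrete.
Variables (k : comNzRingType) (F : frobData k) (n theta : nat).
Hypothesis hF : is_frobData F.
Variables (e : nat -> nat) (C : nat -> nat -> tpow F n.+1).
Notation N := n.+1.
Notation R := (AWC theta e C).
Notation q := (awcMap theta e C).

Definition cX (i : 'I_N) : R := q (awX F i).
Definition cF (f : tpow F N) : R := q (awF f).
Definition cS (s : 'S_N) : R := q (awS F s).

(** Stated for images in the cyclotomic quotient, so that each defining relation is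
transported by a single application. *)
Lemma AW_eq x y : @awRel k F N (x - y) ->
  q (quotMap (@awRel k F N) x) = q (quotMap (@awRel k F N) y).
Proof. by move=> h; congr q; apply: quotMap_eq. Qed.

Lemma qM x y : q (x * y) = q x * q y.
Proof. exact: quotMapM. Qed.

Lemma cyclotomic_rels : wreath_rels cX cF cS.
Proof.
split.
- by move=> i j; rewrite -!qM -!quotMapM; apply/AW_eq/rel_XX.
- move=> a f g; rewrite /cF /awF (AW_eq (rel_Flin a f g)) quotMap_linear.
  by rewrite /awcMap quotMap_linear.
- by rewrite /cF /awF (AW_eq (rel_F1 F N)).
- by move=> f g; rewrite -!qM -!quotMapM; apply/AW_eq/rel_FM.
- by rewrite /cS /awS (AW_eq (rel_S1 F N)).
- by move=> s s'; rewrite -!qM -!quotMapM; apply/AW_eq/rel_SM.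
- by move=> f i; rewrite -!qM -!quotMapM; apply/AW_eq/rel_FX.
- by move=> i i' j h1 h2 h3; rewrite -!qM -!quotMapM; apply/AW_eq/rel_SX0.
- move=> i i' h; rewrite -!qM -!quotMapM /cF /awcMap -quotMapB -quotMapB.
  by apply/AW_eq/rel_SX.
- by move=> s f; rewrite -!qM -!quotMapM; apply/AW_eq/rel_SF.
Qed.

Notation hom := (homGen (wGen cX cF cS)).

Lemma awcHomE : @awcHom k F n theta e C = hom.
Proof.
apply: funext => d; apply: funext => p; apply: funext => u; apply/propext; split.
  case=> a [ha ->{u}]; elim: ha => {d p a}
    [d p _ [i|D' p' f hf|s]||d p|d p c a b _ ha _ hb|D D' p p' a b _ ha _ hb].
  - exact/hom_base/wGen_X.
  - exact/hom_base/wGen_F.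
  - exact/hom_base/wGen_S.
  - exact: hom_one.
  - by rewrite /awcMap (lin_0 (quotMap_linear _)); apply: hom_zero.
  - by rewrite /awcMap quotMap_linear; apply: hom_lin.
  - by rewrite qM; apply: hom_mul.
elim=> {d p u} [d p _ [i|D' p' f hf|s]||d p|d p c a b _ [x [hx ->]] _ [y [hy ->]]
  |D D' p p' a b _ [x [hx ->]] _ [y [hy ->]]].
- exists (awX F i); split=> //; exact/hom_base/awhom_X.
- exists (awF f); split=> //; exact/hom_base/awhom_F.
- exists (awS F s); split=> //; exact/hom_base/awhom_S.
- exists 1; split=> //; exact: hom_one.
- by exists 0; split; [exact: hom_zero | rewrite /awcMap (lin_0 (quotMap_linear _))].
- by exists (c *: x + y); split; [exact: hom_lin | rewrite /awcMap quotMap_linear].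
- by exists (x * y); split; [exact: hom_mul | rewrite qM].
Qed.

Lemma cyclotomic_gen (u : R) : lspan (fun v => exists D p, hom D p v) u.
Proof.
have [a ->] := quotMap_surj u; have [x ->] := quotMap_surj a.
pose Q (v : R) := exists D p, hom D p v.
change (lspan Q (q (quotMap (@awRel k F N) x))).
have mulQ (y z : R) : lspan Q y -> lspan Q z -> lspan Q (y * z).
  move=> hy; apply: (lspan_map (mull_linear _)) => z' [D' [p' hz]].
  move: hy; apply: (lspan_map (mulr_linear _)) => y' [D [p hy]].
  by apply: lspan_base; exists (D + D')%N, (p (+) p'); apply: hom_mul.
elim/freeAlg_ind: x => [||x y hx hy|c x hx|g x hx].
- rewrite (lin_0 (quotMap_linear _)) /awcMap (lin_0 (quotMap_linear _)); exact: lspan0.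
- by apply: lspan_base; exists 0%N, false; apply: hom_one.
- by rewrite quotMapD /awcMap quotMapD; apply: lspanD.
- by rewrite quotMapZ /awcMap quotMapZ; apply: lspanZ.
rewrite quotMapM qM; apply: mulQ => // {x hx}.
case: g => [[i|f]|s].
- by apply: lspan_base; exists (fDelta F), false; apply/hom_base/wGen_X.
- rewrite -/(awF f) -/(cF f) (tpow_expand hF f) (lin_sum (wFlin cyclotomic_rels)).
  apply: lspan_sum => b _; rewrite (lin_Z (wFlin cyclotomic_rels)); apply: lspanZ.
  apply: lspan_base; exists (dgb b), (prb b); apply/hom_base/wGen_F; exact: thom_tbasis.
- by apply: lspan_base; exists 0%N, false; apply/hom_base/wGen_S.
Qed.

Lemma F1_fixed m (U : tpow F N) i : F1 m U -> tpsi i U = U.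
Proof.
case=> [h _]; elim: h => {U} [_ [f [[_ f0] fi ->]]||a U V _ hU _ hV].
- rewrite tpsiE (tpsi_pow_pure hF); apply: pure_ext => j.
  case: (j == i) => //=; have [->|nj] := eqVneq j ord0; first exact: f0.
  by have [_] := fi j nj.
- by rewrite tpsiE (lin_0 (tpsi_pow_linear _)).
- by rewrite tpsi_linear hU hV.
Qed.

Hypothesis hCF1 : forall m j, (1 <= m <= theta)%N -> (j < e m)%N -> F1 m (C m j).
Hypothesis hChom : forall m j, (1 <= m <= theta)%N -> (j < e m)%N ->
      thom (m * fDelta F)%N false (C m j).

(** Each factor x_1^m - c is monic of degree m, so chi is monic of degree the level, and
its image is zero. *)
Lemma chi_monic : monic_X1 cX cF (level theta e) 0.
Proof.
have <- : q (chi theta e C) = 0 by apply: quotMap_rel.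
rewrite /level /chi /awcMap quotMap_prod big_nat_cond [X in monic_X1 _ _ _ X]big_nat_cond.
have M := monic_X1M hF cyclotomic_rels.
elim/big_ind2: _ => [|a u b v|m]; [exact: monic_X1_one | exact: M | ].
rewrite andbT ltnS => hm; rewrite quotMap_prod mulnC.
have -> : (e m * m = \sum_(j < e m) m)%N by rewrite sum_nat_const card_ord.
elim/big_ind2: _ => [|a u b v|j _]; [exact: monic_X1_one | exact: M | ].
rewrite quotMapB quotMapX; apply: monic_X1_base.
- by case/andP: hm.
- exact: hChom.
- by move=> i; apply: F1_fixed (hCF1 _ _).
Qed.

Lemma cyclotomic_frobenius (trC : R -> k) : is_trC trC ->
  frobenius_spec cX cF cS trC (level theta e).
Proof.
move=> [tr_lin trE].
have := chi_monic; move: trE; case: (level theta e) => [|d'] trE hm.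
  have [c [_ _ E]] := monic_X1_zero cyclotomic_rels hm.
  apply: (frobenius_level0 cF cS tr_lin).
  by rewrite E big_ord0.
have [c [chom cpsi E]] := monic_X1_zero cyclotomic_rels hm.
apply: (frobenius_pos hF cyclotomic_rels cyclotomic_gen tr_lin chom cpsi E) => al f s h.
have -> : mon cX al = q (awMon F al).
  rewrite /awMon /awcMap quotMap_prod; apply: eq_bigr => i _.
  by rewrite quotMapX.
by rewrite -(trE al f s h) !qM.
Qed.
End Concrete.

(** Nondegeneracy determines the Nakayama automorphism of F. *)
Lemma nakayama_unique (k : comNzRingType) (F : frobData k) :
  is_frobData F -> is_nakayama (fHom F) (fTr F) id -> fPsi F =1 id.
Proof.
move=> hF [_ _ _ H].
have gF := gf_graded (fd_frobenius hF).
apply: (hom_ext gF (psi_linear hF)) => [//|d p f hf].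
apply: (coef_inj hF) => b; have [D hb _] := dual_hom hF b.
have := H _ _ _ _ _ _ hf hb; rewrite (psi_tr hF hf hb).
move=> /(congr1 ( *%R ((-1) ^+ (p && fPar F b)))).
by rewrite !mulrA -signr_addb addbb !mul1r.
Qed.

Theorem theorem6p15 (k : comNzRingType) (ch : nat) (hch : has_char k ch)
    (hch2 : ch <> 2%N)
    (F : frobData k) (hF : is_frobData F)
    (theta : nat) (htheta : has_order (fPsi F) theta)
    (hchtheta : ~~ (ch %| theta)%N) (heig : eigenbasis F)
    (n : nat)
    (e : nat -> nat) (C : nat -> nat -> tpow F n.+1)
    (hCF1 : forall m j, (1 <= m <= theta)%N -> (j < e m)%N -> F1 m (C m j))
    (hChom : forall m j, (1 <= m <= theta)%N -> (j < e m)%N ->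
      thom (m * fDelta F)%N false (C m j))
    (trC : AWC theta e C -> k) (htrC : is_trC trC) :
  let d := level theta e in
  [/\ graded_frobenius (@awcHom _ _ _ theta e C) trC,
      exists Psi : AWC theta e C -> AWC theta e C,
        [/\ is_nakayama (@awcHom _ _ _ theta e C) trC Psi,
            forall i, Psi (awcMap theta e C (awX F i)) = awcMap theta e C (awX F i),
            forall f, Psi (awcMap theta e C (awF f)) =
              awcMap theta e C (awF (tmap (fun _ => iter d (fPsi F)) f))
          & forall s, Psi (awcMap theta e C (awS F s)) =
              awcMap theta e C (awS F s)],
      (theta %| d)%N -> symmetric_algebra (@awcHom _ _ _ theta e C) trC
    & symmetric_algebra (fHom F) (fTr F) ->
        symmetric_algebra (@awcHom _ _ _ theta e C) trC].
Proof.
move=> d; rewrite awcHomE.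
have [frob [Psi [nPsi PX PF PS]]] := cyclotomic_frobenius hF hCF1 hChom htrC.
have sym : (forall f : F, iter d (fPsi F) f = f) ->
    symmetric_algebra (homGen (wGen (@cX _ _ _ theta e C) (@cF _ _ _ theta e C)
      (@cS _ _ _ theta e C))) trC.
  move=> id_d; split; first exact: frob.
  apply: (nakayama_id_of_fixed (@cyclotomic_gen _ _ _ theta hF e C) nPsi PX) => [f|].
    2: exact: PS.
  by rewrite PF; congr (cF _ _ _ _); apply: (tmap_id hF) => i x; exact: id_d.
split; first exact: frob.
- by exists Psi; split; [exact: nPsi | exact: PX | exact: PF | exact: PS].
- move=> /dvdnP[m Ed]; apply: sym => f; rewrite Ed.
  have [_ ord1 _] := htheta; elim: m {Ed} => [|m IH]; first by rewrite mul0n.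
  by rewrite mulSn iterD IH ord1.
- move=> [_ /(nakayama_unique hF) psi1]; apply: sym => f.
  by elim: d => [|m IH]; [| rewrite iterS IH psi1].
Qed.
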